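(* Let $(\mathcal G,\lambda,\mu)$ be a measured groupoid, where $\lambda$ is a left Haar system. Then $(\mathcal G,\lambda,\mu)$ is Liouville if and only if it is Reiter.
   Context: A groupoid is a small category in which every morphism is invertible: a set $\mathcal G$ of morphisms, a set $\mathcal G^{(0)}$ of objects (units), surjective source and target maps $\mathbf s,\mathbf t:\mathcal G\to\mathcal G^{(0)}$, and a composition $(\zeta,\eta)\mapsto\zeta\eta$ defined on $\{(\zeta,\eta)\in\mathcal G^2:\mathbf s(\zeta)=\mathbf t(\eta)\}$. Units are identified with identity morphisms, so $\mathcal G^{(0)}\subseteq\mathcal G$. For $x\in\mathcal G^{(0)}$ put $\mathcal G^x=\mathbf t^{-1}(x)$. An analytic Borel space is a measurable space isomorphic to an analytic subset (continuous image of a Polish space) of a Polish space with the relative Borel structure. A Borel groupoid is a groupoid $\mathcal G$ such that $\mathcal G$ is an analytic Borel space, $\mathcal G^{(0)}$ is an analytic Borel space as a subspace of $\mathcal G$, and $\mathbf s$, $\mathbf t$ and the composition are Borel. A Borel system of measures on $\mathcal G$ is a family $\lambda=(\lambda^x)_{x\in\mathcal G^{(0)}}$ of $\sigma$-finite positive Borel measures $\lambda^x$ on $\mathcal G^x$ (regarded also as measures on $\mathcal G$ vanishing outside $\mathcal G^x$) such that $x\mapsto\int_{\mathcal G}f\,d\lambda^x\in[0,\infty]$ is Borel for every non-negative Borel function $f$ on $\mathcal G$. For $\gamma\in\mathcal G$ and a measure $\rho$ on $\mathcal G^{\mathbf s(\gamma)}$, $\gamma\rho$ denotes the pushforward of $\rho$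 under $\mathcal G^{\mathbf s(\gamma)}\to\mathcal G^{\mathbf t(\gamma)}$, $\eta\mapsto\gamma\eta$; $\prec$ denotes absolute continuity. A Borel system $\lambda$ is a left Haar system if $\gamma\lambda^{\mathbf s(\gamma)}=\lambda^{\mathbf t(\gamma)}$ for all $\gamma\in\mathcal G$ and $(\gamma,\eta)\in\mathcal G^2\mapsto\frac{d(\gamma\lambda^{\mathbf s(\gamma)})}{d\lambda^{\mathbf t(\gamma)}}(\eta)\in[0,\infty]$ is Borel. A Borel system $\lambda$ is proper if there is an increasing sequence of Borel sets $A_n$ with $\mathcal G=\bigcup_nA_n$ such that for each $n$ the map $x\mapsto\lambda^x(A_n)\in\mathbb R$ is bounded. A measured groupoid is a triple $(\mathcal G,\lambda,\mu)$ with $\mathcal G$ a Borel groupoid, $\lambda$ a proper left Haar system on $\mathcal G$ and $\mu$ a positive Borel measure on $\mathcal G^{(0)}$. A Borel system $\theta=(\theta^x)_{x\in\mathcal G^{(0)}}$ of probability measures $\theta^x$ on $\mathcal G^x$ is $\lambda$-adapted if $\theta^x\prec\lambda^x$ for every $x$ and $(\gamma,\eta)\in\mathcal G^2\mapsto\frac{d(\gamma\theta^{\mathbf s(\gamma)})}{d\lambda^{\mathbf t(\gamma)}}(\eta)\in[0,\infty]$ is Borel. The measure $\mu\star\lambda$ on $\mathcal G$ is $(\mu\star\lambda)(E)=\int_{\mathcal G^{(0)}}\lambda^x(E)\,d\mu(x)$. $\|\cdot\|$ is the total variation norm. $(\mathcal G,\lambda,\mu)$ is Reiter if there is a sequence $(\theta_n)_n$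 of $\lambda$-adapted Borel systems of probability measures $\theta_n=(\theta_n^x)_x$ such that $\lim_{n\to\infty}\int_{\mathcal G}\|\theta_n^{\mathbf t(\gamma)}-\gamma\theta_n^{\mathbf s(\gamma)}\|f(\gamma)\,d(\mu\star\lambda)(\gamma)=0$ for all $f\in L^1(\mathcal G,\mu\star\lambda)$. For a $\lambda$-adapted Borel system of probability measures $\pi=(\pi_x)_x$, define $P_x:L^\infty(\mathcal G^x,\lambda^x)\to L^\infty(\mathcal G^x,\lambda^x)$ by $P_x(f)(\zeta)=\int_{\mathcal G^{\mathbf s(\zeta)}}f(\zeta\eta)\,d\pi_{\mathbf s(\zeta)}(\eta)$, and $H_{\pi,x}(\mathcal G)=\{f\in L^\infty(\mathcal G^x,\lambda^x):P_x(f)=f\}$. $(\mathcal G,\lambda,\mu)$ is Liouville if there is a $\lambda$-adapted Borel system of probability measures $\pi$ with $H_{\pi,x}(\mathcal G)=\mathbb C\mathbf 1$ (the constants) for $\mu$-a.e. $x\in\mathcal G^{(0)}$.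
   Formalization: The measure μ on the unit space is assumed σ-finite; for arbitrary positive Borel measures the claim fails, e.g. for the free group F₂ with counting measure and μ = ∞·δ, where L¹(μ⋆λ) = {0} makes Reiter trivial while Liouville fails. *)

(* Defs.v *)
From HB Require Import structures.
From mathcomp Require Import all_boot all_order all_algebra.
From mathcomp Require Import all_classical all_reals all_analysis.
From mathcomp Require Import measurable_realfun complex.

Set Implicit Arguments.
Unset Strict Implicit.
Unset Printing Implicit Defensive.

Import Order.TTheory GRing.Theory Num.Theory.
Import numFieldNormedType.Exports.

Local Open Scope classical_set_scope.
Local Open Scope ring_scope.
Local Open Scope complex_scope.

(* A pseudometric structure of the library is a countably generated
   uniformity; it is metrizable exactly when it is Hausdorff. *)
Definition polish {R : realType} (P : completePseudoMetricType R) : Prop :=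
  hausdorff_space P /\ exists2 S : set P, countable S & dense S.

Definition analytic_set {R : realType} (P : completePseudoMetricType R)
    (A : set P) : Prop :=
  exists (Q : completePseudoMetricType R) (f : Q -> P),
    [/\ polish Q, continuous f & range f = A].

(* [phi] is a Borel isomorphism of [T] onto the analytic set [range phi]. *)
Definition analytic_borel_space (R : realType) d (T : measurableType d) : Prop :=
  exists (P : completePseudoMetricType R) (phi : T -> P),
    [/\ polish P, analytic_set (range phi), injective phi &
      forall E : set T, measurable E <->
        exists2 B : set P, <<s @open P >> B & E = phi @^-1` B].

(* Groupoid with objects [X] and arrows [G].  [comp] is total, but its values
   matter only at pairs [(g, h)] with [src g = tgt h]. *)
Record groupoid (X G : Type) := Groupoid {
  src : G -> X;
  tgt : G -> X;
  unit_arrow : X -> G;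
  inv_arrow : G -> G;
  comp : G -> G -> G;
  src_unit : forall x, src (unit_arrow x) = x;
  tgt_unit : forall x, tgt (unit_arrow x) = x;
  src_comp : forall g h, src g = tgt h -> src (comp g h) = src h;
  tgt_comp : forall g h, src g = tgt h -> tgt (comp g h) = tgt g;
  compA : forall g h k, src g = tgt h -> src h = tgt k ->
    comp g (comp h k) = comp (comp g h) k;
  comp_unitl : forall g, comp (unit_arrow (tgt g)) g = g;
  comp_unitr : forall g, comp g (unit_arrow (src g)) = g;
  src_inv : forall g, src (inv_arrow g) = tgt g;
  tgt_inv : forall g, tgt (inv_arrow g) = src g;
  comp_invl : forall g, comp (inv_arrow g) g = unit_arrow (src g);
  comp_invr : forall g, comp g (inv_arrow g) = unit_arrow (tgt g)
}.

Definition fibre X G (Gd : groupoid X G) (x : X) : set G :=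
  tgt Gd @^-1` [set x].

Definition composable X G (Gd : groupoid X G) : set (G * G) :=
  [set p | src Gd p.1 = tgt Gd p.2].

(* The third clause says that [X] carries the Borel structure of the subspace
   [range (unit_arrow Gd)] of [G].  The set [composable Gd] is Borel,
   since the diagonal of an analytic Borel space is. *)
Definition borel_groupoid (R : realType) dX dG
    (X : measurableType dX) (G : measurableType dG) (Gd : groupoid X G) : Prop :=
  analytic_borel_space R G /\
  analytic_borel_space R X /\
  (forall A : set X, measurable A <->
     exists2 B : set G, measurable B & A = unit_arrow Gd @^-1` B) /\
  measurable_fun [set: G] (src Gd) /\
  measurable_fun [set: G] (tgt Gd) /\
  measurable_fun (composable Gd) (fun p : G * G => comp Gd p.1 p.2).

Record borel_system (R : realType) dX dG
    (X : measurableType dX) (G : measurableType dG) (Gd : groupoid X G) :=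
  BorelSystem {
    system_measure :> X -> {measure set G -> \bar R};
    system_sigma_finite : forall x, sigma_finite [set: G] (system_measure x);
    system_fibre : forall x, system_measure x (~` fibre Gd x) = 0%E;
    system_borel : forall f : G -> \bar R,
      (forall g, (0 <= f g)%E) -> measurable_fun [set: G] f ->
      measurable_fun [set: X] (fun x => \int[system_measure x]_g f g)%E
  }.

Section measured_groupoids.
Context {R : realType} {dX dG : measure_display}
  {X : measurableType dX} {G : measurableType dG} {Gd : groupoid X G}.

(* For [rho] carried by [fibre Gd (src Gd g)], the push-forward of [rho] under
   left multiplication by [g]. *)
Definition translate (g : G) (rho : set G -> \bar R) (E : set G) : \bar R :=
  rho (fibre Gd (src Gd g) `&` comp Gd g @^-1` E).

(* The Radon-Nikodym derivatives of the [g theta^(src g)] with respect to the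
   [lam^(tgt g)] exist and have a jointly Borel version [D].  The values of
   [D (g, h)] with [tgt g != tgt h] play no role. *)
Definition has_borel_derivative (theta lam : borel_system R Gd) : Prop :=
  exists D : G * G -> \bar R,
    [/\ forall p, (0 <= D p)%E,
        measurable_fun [set: G * G] D &
        forall (g : G) (E : set G), measurable E ->
          (translate g (theta (src Gd g)) E
             = \int[lam (tgt Gd g)]_(h in E) D (g, h))%E].

Definition left_haar (lam : borel_system R Gd) : Prop :=
  (forall (g : G) (E : set G), measurable E ->
     translate g (lam (src Gd g)) E = lam (tgt Gd g) E) /\
  has_borel_derivative lam lam.

Definition proper_system (lam : borel_system R Gd) : Prop :=
  exists A : (set G)^nat,
    [/\ forall n, measurable (A n),
        nondecreasing_seq A,
        \bigcup_n A n = [set: G] &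
        forall n, exists M : R, forall x, (lam x (A n) <= M%:E)%E].

Definition measured_groupoid (lam : borel_system R Gd)
    (mu : {measure set X -> \bar R}) : Prop :=
  [/\ borel_groupoid R Gd, left_haar lam & proper_system lam].

Definition adapted_probability (lam theta : borel_system R Gd) : Prop :=
  [/\ forall x, theta x [set: G] = 1%E,
      forall x, theta x `<< lam x &
      has_borel_derivative theta lam].

Lemma system_measurable (lam : borel_system R Gd) (E : set G) :
  measurable E -> measurable_fun [set: X] (fun x => lam x E).
Proof.
move=> mE.
have := @system_borel _ _ _ _ _ _ lam (fun g => (\1_E g)%:E).
rewrite [X in _ -> _ -> measurable_fun _ X](_ : _ = fun x => lam x E).
  by apply => [g|]; [rewrite lee_fin|exact/measurable_EFinP].
by apply/funext => x; rewrite integral_indic// setIT.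
Qed.

Definition star (mu : {measure set X -> \bar R}) (lam : borel_system R Gd)
    (E : set G) : \bar R :=
  (\int[mu]_x lam x E)%E.

Section star_measure.
Context (mu : {measure set X -> \bar R}) (lam : borel_system R Gd).

Let star0 : star mu lam set0 = 0%E.
Proof. by rewrite /star integral0_eq// => x _; rewrite measure0. Qed.

Let star_ge0 E : (0 <= star mu lam E)%E.
Proof. exact: integral_ge0. Qed.

Let star_sigma_additive : semi_sigma_additive (star mu lam).
Proof.
move=> U mU tU mUU; rewrite [X in _ --> X](_ : _ =
  (\int[mu]_x (\sum_(n <oo) lam x (U n)))%E); last first.
  apply: eq_integral => x _.
  by apply/esym/cvg_lim => //; exact/measure_semi_sigma_additive.
apply/cvg_closeP; split.
  by apply: is_cvg_nneseries => n _ _; exact: integral_ge0.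
by rewrite closeE// integral_nneseries// => n; exact: system_measurable.
Qed.

HB.instance Definition _ := isMeasure.Build _ _ _ (star mu lam)
  star0 star_ge0 star_sigma_additive.

End star_measure.

End measured_groupoids.

Arguments translate {R dX dG X G} Gd g rho E.

Definition total_variation_norm {R : realType} d (T : measurableType d)
    (nu : set T -> \bar R) : \bar R :=
  ereal_sup [set (\sum_(k <oo) `|nu (F k)|)%E | F in
    [set F : (set T)^nat | [/\ forall k, measurable (F k),
                               trivIset setT F & \bigcup_k F k = [set: T]]]].

Section complex_functions.
Context {R : realType} {d : measure_display} {T : measurableType d}.
Implicit Types (mu : {measure set T -> \bar R}) (D : set T) (f : T -> R[i]).

Definition cmeasurable_fun D f : Prop :=
  measurable_fun D (fun x => complex.Re (f x)) /\
  measurable_fun D (fun x => complex.Im (f x)).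

Definition cintegral mu D f : R[i] :=
  (\int[mu]_(x in D) complex.Re (f x)) +i* (\int[mu]_(x in D) complex.Im (f x)).

Definition cintegrable mu f : Prop :=
  cmeasurable_fun [set: T] f /\
  (\int[mu]_x (ComplexField.Normc.normc (f x))%:E < +oo)%E.

Definition Linfty mu D f : Prop :=
  cmeasurable_fun D f /\
  exists M : R, {ae mu, forall x, D x -> ComplexField.Normc.normc (f x) <= M}.

End complex_functions.

Section reiter_liouville.
Context {R : realType} {dX dG : measure_display}
  {X : measurableType dX} {G : measurableType dG} {Gd : groupoid X G}.

Definition reiter_defect (theta : borel_system R Gd) (g : G) : \bar R :=
  total_variation_norm (fun E : set G =>
    theta (tgt Gd g) E - translate Gd g (theta (src Gd g)) E)%E.

(* [reiter_defect] takes its values in [0, 2], so [fine] loses nothing. *)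
Definition reiter (lam : borel_system R Gd)
    (mu : {measure set X -> \bar R}) : Prop :=
  exists theta : nat -> borel_system R Gd,
    (forall n, adapted_probability lam (theta n)) /\
    forall f : G -> R[i], cintegrable (star mu lam) f ->
      (fun n => cintegral (star mu lam) [set: G]
                  (fun g => (fine (reiter_defect (theta n) g))%:C * f g)
                : R[i]^o) @ \oo --> (0 : R[i]^o).

Definition markov (pi : borel_system R Gd) (f : G -> R[i]) (g : G) : R[i] :=
  cintegral (pi (src Gd g)) (fibre Gd (src Gd g)) (fun h => f (comp Gd g h)).

(* The space H_(pi, x), as a set of representatives: functions on [G] are
   considered on [fibre Gd x] only, up to equality [lam x]-almost everywhere. *)
Definition harmonic (lam pi : borel_system R Gd) (x : X) (f : G -> R[i]) : Prop :=
  Linfty (lam x) (fibre Gd x) f /\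
  ae_eq (lam x) (fibre Gd x) (markov pi f) f.

Definition liouville (lam : borel_system R Gd)
    (mu : {measure set X -> \bar R}) : Prop :=
  exists2 pi : borel_system R Gd, adapted_probability lam pi &
    {ae mu, forall x, forall f : G -> R[i], Linfty (lam x) (fibre Gd x) f ->
      (harmonic lam pi x f <->
       exists c : R[i], ae_eq (lam x) (fibre Gd x) f (cst c))}.

End reiter_liouville.

(* Main.v *)
Require Import Defs.
From HB Require Import structures.
From mathcomp Require Import all_boot all_order all_algebra.
From mathcomp Require Import all_classical all_reals all_analysis.
From mathcomp Require Import measurable_realfun complex.
From mathcomp Require Import finmap ring lra.

Set Implicit Arguments.
Unset Strict Implicit.
Unset Printing Implicit Defensive.

Import Order.TTheory GRing.Theory Num.Theory.
Import numFieldNormedType.Exports.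

Local Open Scope classical_set_scope.
Local Open Scope ring_scope.


(** The whole argument takes place on one fibre of the target map at a time.

    The translates [g theta^(src g)] of an adapted system [theta] have densities
    [t (g, -)] with respect to [lam^(tgt g)], so that the Markov operator on the
    fibre over [x] is the integral operator [act lam t] with kernel [t].  The
    kernels which arise in this way are the [transition]s: positive, of mass
    one, and invariant under left multiplication ([adapted_transition],
    [transition_adapted]).  They are stable under convolution and geometric
    means, and the Reiter defect of [theta] at [g] is the L1 distance between
    [t (g, -)] and [t (1, -)], where [1] is the unit at [tgt g]
    ([reiter_defectE]).  Since [mu] need not be quasi-invariant, it is essential
    that a condition at almost every [x] is only ever used on the fibre over
    that same [x].

    Liouville implies Reiter.  Let [pi] be a system whose bounded harmonic
    functions are constant on almost every fibre, with Markov operator [P], and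
    let [theta_n] be the Abel mean of the convolution powers of [pi] with
    parameter [1 - 1/(n+1)].  For a Borel set [B] the function
    [u z = (z theta_n) B] satisfies [|P u - u| <= 1/(n+1)].  If the defect of
    [theta_n] at some [g] over a good [x] did not tend to 0, then for all [n]
    there would be such a [u], with values in the unit interval, for which
    [u 1 - u g] is bounded below.  For each [n] these functions form a convex
    set, and the sets decrease with [n], so the parallelogram law in a weighted
    L2 space provides a sequence of them that converges almost everywhere
    ([midpoint_convex_ae_cvg]).  The limit is harmonic, hence constant; as
    transition probabilities have densities, the convergence to this constant
    holds at every point of the fibre, in particular at [1] and at [g]: a
    contradiction ([abel_mean_defect_cvg]).  Dominated convergence then gives
    the Reiter condition ([liouville_reiter]).

    Reiter implies Liouville.  As in the construction of Kaimanovich and Vershik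
    for groups, [pi] is the sum of [c_j theta_(n_j)], [c_j = 2^-(j+1)], where
    each [n_j] is chosen large in terms of the previous ones.  Let [Q_k] be the
    part [j < k] of its Markov operator and let [v], with values in the unit
    interval, be harmonic on a fibre.  The remaining part maps [v] to a function
    which differs from a constant [2^-k A_k] by at most [r_k], the sum of the
    [c_j d_(n_j)] over [j >= k], where [d_n] is the defect of [theta_n].
    Therefore [u = |v - A_k|] satisfies [u <= Q_k u + r_k].  Integrate this
    against a weight [F_k] with [F_0 + Q_k^* F_k <= F_k], built from the Green
    operator of the adjoint of [Q_k]: the terms with [Q_k] cancel, and the
    integral of [F_0 |v - A_k|] is at most that of [F_k r_k]
    ([harmonic_constant]).  The weight [F_k] only depends on the [n_j] with
    [j < k], so the Reiter condition for [F_k] yields an [n_k] for which the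
    integral of [F_k d_(n_k)] is at most [c_k].  On almost every fibre the
    integrals of [F_0 |v - A_k|] are then summable, so that [A_k] converges to
    [v] almost everywhere and [v] is constant
    ([exists_mean_with_constant_harmonics], [reiter_liouville]). *)

(** * Series and integrals of nonnegative functions *)

Lemma eseries_geometric (R : realType) (s : R) : 0 <= s < 1 ->
  (\sum_(n <oo) ((1 - s) * s ^+ n)%:E = 1)%E.
Proof.
move=> /andP[s0 s1].
have := @cvg_geometric_series R (1 - s) s; rewrite ger0_norm// => /(_ s1).
rewrite divff ?subr_eq0 ?gt_eqF// => h.
rewrite (_ : (fun n => _) = (EFin \o series (geometric (1 - s) s))); last first.
  by apply/funext => n /=; rewrite sumEFin.
by apply/cvg_lim => //; apply: cvg_EFin => //; exact: nearW.
Qed.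

Section ge0_measurable_ind.
Import HBNNSimple.
Local Open Scope ereal_scope.
Context d (T : measurableType d) (R : realType).
Variable P : (T -> \bar R) -> Prop.
Hypothesis P_indic : forall E, measurable E -> P (fun x => (\1_E x)%:E).
Hypothesis P_add : forall f g, (forall x, 0 <= f x) -> (forall x, 0 <= g x) ->
  measurable_fun [set: T] f -> measurable_fun [set: T] g ->
  P f -> P g -> P (fun x => f x + g x).
Hypothesis P_scale : forall (c : R) f, (0 <= c)%R -> (forall x, 0 <= f x) ->
  measurable_fun [set: T] f -> P f -> P (fun x => c%:E * f x).
Hypothesis P_lim : forall f_ : (T -> \bar R)^nat, (forall n x, 0 <= f_ n x) ->
  (forall n, measurable_fun [set: T] (f_ n)) ->
  (forall x, nondecreasing_seq (f_ ^~ x)) ->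
  (forall n, P (f_ n)) -> P (fun x => limn (f_ ^~ x)).

(** The standard machine: simple functions, then monotone limits. *)
Lemma ge0_measurable_ind f : (forall x, 0 <= f x) ->
  measurable_fun [set: T] f -> P f.
Proof.
move=> f0 mf; pose f_ := nnsfun_approx measurableT mf.
have -> : f = (fun x => limn (fun n => (f_ n x)%:E)).
  by apply/funext => x; apply/esym/cvg_lim => //; exact: cvg_nnsfun_approx.
apply: P_lim.
- by move=> n x; rewrite lee_fin.
- by move=> n; exact/measurable_EFinP.
- by move=> x m n mn; rewrite lee_fin; exact/lefP/nd_nnsfun_approx.
move=> n; set h := f_ n.
have -> : (fun x => (h x)%:E) =
    (fun x => \sum_(r <- enum_fset (fset_set (range h)))
      (r%:E * (\1_(h @^-1` [set r]) x)%:E)).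
  apply/funext => x; rewrite [in LHS]fimfunE fsbig_finite//= -sumEFin.
  by under [in LHS]eq_bigr do rewrite EFinM.
have : forall r, r \in enum_fset (fset_set (range h)) -> (0 <= r)%R.
  move=> r; rewrite in_fset_set// => /set_mem[x _ <-]; exact: fun_ge0.
move: (enum_fset (fset_set (range h))); elim=> [_|r s ih rs].
  rewrite [X in P X](_ : _ = fun x => (\1_set0 x)%:E); first exact: P_indic.
  by apply/funext => x; rewrite big_nil indic0.
have mi (r' : R) : measurable_fun setT (fun x => (\1_(h @^-1` [set r']) x)%:E : \bar R).
  by apply/measurable_EFinP; exact: measurable_indic.
have s0 r' : r' \in s -> (0 <= r')%R by move=> r's; apply: rs; rewrite inE r's orbT.
have r0 : (0 <= r)%R by apply: rs; rewrite inE eqxx.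
rewrite [X in P X](_ : _ = fun x => r%:E * (\1_(h @^-1` [set r]) x)%:E +
  \sum_(r0 <- s) (r0%:E * (\1_(h @^-1` [set r0]) x)%:E)); last first.
  by apply/funext => x; rewrite big_cons.
apply: P_add.
- by move=> x; rewrite mule_ge0// lee_fin.
- move=> x; rewrite big_seq; apply: sume_ge0 => r' /s0 r'0.
  by rewrite mule_ge0// lee_fin.
- exact: measurable_funeM.
- by apply: emeasurable_sum => r'; exact: measurable_funeM.
- apply: P_scale => //; by apply: P_indic; exact: measurable_sfunP.
- exact: ih.
Qed.

End ge0_measurable_ind.

Section positive_integrals.
Local Open Scope ereal_scope.
Context d (T : measurableType d) (R : realType).
Implicit Types m : {measure set T -> \bar R}.

Lemma sigma_finite_tonelli m (f : T * T -> \bar R) :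
  sigma_finite [set: T] m -> (forall z, 0 <= f z) -> measurable_fun [set: T * T] f ->
  \int[m]_x \int[m]_y f (x, y) = \int[m]_y \int[m]_x f (x, y).
Proof.
move=> sm f0 mf.
pose H1 := isSFinite.Build _ _ _ _ (sfinite_measure_sigma_finite sm).
pose H2 := isSigmaFinite.Build _ _ _ _ sm.
pose m' : {sigma_finite_measure set T -> \bar R} := 
  HB.pack_for (SigmaFiniteMeasure.type T R) (Measure.sort m) H1 H2.
exact: (@fubini_tonelli _ _ _ _ _ m' m' f mf f0).
Qed.

(** Weights of this kind replace a finite measure equivalent to [m].  The value
    [+oo] at some points does no harm: only the integral and positivity matter. *)
Lemma exists_positive_integrable m : sigma_finite [set: T] m ->
  exists F : T -> \bar R, [/\ forall x, 0 < F x, measurable_fun [set: T] F &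
    \int[m]_x F x < +oo].
Proof.
move=> [A AT Afin].
have mA n : measurable (A n) by case: (Afin n).
(* The integral of the n-th summand is at most [2^-n]. *)
pose c n : R := ((1 / 2) ^+ n / (1 + fine (m (A n))))%R.
have c0 n : (0 < c n)%R.
  by rewrite divr_gt0// ?exprn_gt0// ltr_wpDr// fine_ge0.
have mc n : measurable_fun setT (fun x => (c n)%:E * (\1_(A n) x)%:E).
  apply: measurable_funeM; apply/measurable_EFinP; exact: measurable_indic.
exists (fun x => \sum_(n <oo) ((c n)%:E * (\1_(A n) x)%:E)); split.
- move=> x; have [n _ Anx] : (\bigcup_n A n) x by rewrite -AT.
  have : (c n)%:E * (\1_(A n) x)%:E <= \sum_(n <oo) ((c n)%:E * (\1_(A n) x)%:E).
    rewrite [leRHS](@nneseriesD1 _ _ n)//; last first.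
      by move=> k _; rewrite mule_ge0// lee_fin// ltW.
    rewrite leeDl//; apply: nneseries_ge0 => k _ _.
    by rewrite mule_ge0// lee_fin// ltW.
  by apply: lt_le_trans; rewrite indicE mem_set// mule1 lte_fin.
- apply: ge0_emeasurable_sum => // n x _ _.
  by rewrite mule_ge0// lee_fin// ltW.
- rewrite integral_nneseries//; last first.
    by move=> n x _; rewrite mule_ge0// lee_fin// ltW.
  apply: (@le_lt_trans _ _
    (\sum_(n <oo) (2%:E * ((1 - 1 / 2) * (1 / 2) ^+ n)%:E))); last first.
    rewrite nneseriesZl; last first.
      by move=> n _; rewrite lee_fin mulr_ge0 ?exprn_ge0//; lra.
    by rewrite eseries_geometric ?mule1 ?ltry//; lra.
  apply: lee_nneseries => [n _ _|n _].
    by apply: integral_ge0 => x _; rewrite mule_ge0// lee_fin// ltW.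
  rewrite ge0_integralZl//; last 2 first.
    by apply/measurable_EFinP; exact: measurable_indic.
    by rewrite lee_fin ltW.
  rewrite integral_indic// setIT -[m (A n)]fineK; last first.
    by rewrite ge0_fin_numE//; case: (Afin n).
  rewrite -!EFinM lee_fin /c /= mulrA.
  rewrite [X in (_ <= X * _)%R](_ : _ = 1%R) ?mul1r -?mulrA; last by field.
  rewrite ler_piMr// ?exprn_ge0//.
  have a0 : (0 <= fine (m (A n)))%R by exact: fine_ge0.
  by rewrite ler_pdivrMl; lra.
Qed.

End positive_integrals.

Lemma cvgn_series_summable (R : realType) (b : R^nat) : (forall n, 0 <= b n) ->
  (\sum_(n <oo) (b n)%:E < +oo)%E -> cvgn (series b).
Proof.
move=> b0 h; apply: nondecreasing_is_cvgn; first exact: nondecreasing_series.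
exists (fine (\sum_(n <oo) (b n)%:E)) => _ [n _ <-].
rewrite -lee_fin fineK; last first.
  by rewrite ge0_fin_numE// nneseries_ge0// => k _; rewrite lee_fin.
rewrite /series/= -sumEFin.
by apply: (@nneseries_lim_ge _ (fun n => (b n)%:E)) => k _; rewrite lee_fin.
Qed.

Lemma cvg_abs_summable (R : realType) (u : R^nat) :
  (\sum_(n <oo) (`|u n.+1 - u n|)%:E < +oo)%E -> cvgn u.
Proof.
move=> h; have hn : cvgn [normed series (telescope u)].
  by apply: cvgn_series_summable => // n; exact: normr_ge0.
have := normed_cvg hn; rewrite telescopeK => hc.
have -> : u = (fun n => (u n - u 0%N) + u 0%N) by apply/funext => n; rewrite subrK.
by apply: is_cvgD => //; exact: is_cvg_cst.
Qed.

Section summable.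
Local Open Scope ereal_scope.
Context d (T : measurableType d) (R : realType).
Variable m : {measure set T -> \bar R}.

Lemma ae_lty_integral (f : T -> \bar R) : (forall x, 0 <= f x) ->
  measurable_fun [set: T] f -> \int[m]_x f x < +oo -> {ae m, forall x, f x < +oo}.
Proof.
move=> f0 mf fi.
have : m.-integrable [set: T] f.
  by apply/integrableP; split => //; under eq_integral do rewrite gee0_abs//.
move=> /integrable_ae -/(_ measurableT); apply: filterS => x /(_ I).
by rewrite ge0_fin_numE.
Qed.

(** Monotone convergence: the sum of the [F * w n] is integrable, hence finite
    almost everywhere, and [F] does not vanish. *)
Lemma ae_weighted_summable (F : T -> \bar R) (w : (T -> \bar R)^nat) :
  (forall x, 0 < F x) -> measurable_fun [set: T] F ->
  (forall n x, 0 <= w n x) -> (forall n, measurable_fun [set: T] (w n)) ->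
  \sum_(n <oo) \int[m]_x (F x * w n x) < +oo ->
  {ae m, forall x, \sum_(n <oo) w n x < +oo}.
Proof.
move=> F0 mF w0 mw.
have Fw0 n x : 0 <= F x * w n x by rewrite mule_ge0// ltW.
rewrite -integral_nneseries//; last by move=> n; exact: emeasurable_funM.
move=> /ae_lty_integral h.
have : {ae m, forall x, \sum_(n <oo) (F x * w n x) < +oo}.
  apply: h => [x|]; first by rewrite nneseries_ge0.
  by apply: ge0_emeasurable_sum => // n _; exact: emeasurable_funM.
apply: filterS => x Fx.
have [r [r0 rF]] : exists r : R, (0 < r)%R /\ r%:E <= F x.
  case: (F x) (F0 x) => [r r0|_|//]; first by exists r; rewrite -lte_fin.
  by exists 1%R; split => //; exact: leey.
have : r%:E * \sum_(n <oo) w n x < +oo.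
  rewrite -nneseriesZl//; apply: le_lt_trans Fx.
  apply: lee_nneseries => [n _ _|n _]; last by rewrite lee_wpmul2r.
  by rewrite mule_ge0// lee_fin ltW.
have : 0 <= \sum_(n <oo) w n x by apply: nneseries_ge0.
case: (\sum_(n <oo) w n x) => [s _ _|_|//]; first exact: ltry.
by rewrite gt0_muley.
Qed.

End summable.

(** * Total variation distance of two densities *)

Section total_variation.
Local Open Scope ereal_scope.
Context d (T : measurableType d) (R : realType).
Variable m : {measure set T -> \bar R}.

Section real_densities.
Variables a b : T -> R.
Hypotheses (ia : m.-integrable [set: T] (EFin \o a))
  (ib : m.-integrable [set: T] (EFin \o b)).

Let iab : m.-integrable [set: T] (EFin \o (fun x => a x - b x)%R).
Proof.
rewrite (_ : _ \o _ = (EFin \o a) \- (EFin \o b)); last by apply/funext => x /=.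
exact: integrableB.
Qed.

Let mab : measurable_fun [set: T] (fun x => a x - b x)%R.
Proof. by have /measurable_int/measurable_EFinP := iab. Qed.

Let intab E : measurable E ->
  \int[m]_(x in E) (a x)%:E - \int[m]_(x in E) (b x)%:E
  = \int[m]_(x in E) (a x - b x)%:E.
Proof.
move=> mE; rewrite -integralB_EFin//.
- exact: integrableS ia.
- exact: integrableS ib.
Qed.

Let B := [set x | (b x <= a x)%R].

Let mB : measurable B.
Proof.
have -> : B = [set: T] `&` (fun x => a x - b x)%R @^-1` `[0%R, +oo[.
  by apply/seteqP; split => x; rewrite /B/= in_itv/= andbT subr_ge0 => // -[].
exact: mab.
Qed.

Let split_abs : \int[m]_x (`|a x - b x|)%:E =
  \int[m]_(x in B) (a x - b x)%:E + `|\int[m]_(x in ~` B) (a x - b x)%:E|.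
Proof.
rewrite -(setUv B) ge0_integral_setU//=; last 3 first.
- exact: measurableC.
- by rewrite setUv; apply/measurable_EFinP; exact: measurableT_comp.
- exact/disj_setPCl.
congr (_ + _).
  by apply: eq_integral => x /set_mem Bx; rewrite ger0_norm// subr_ge0.
have ic : \int[m]_(x in ~` B) (a x - b x)%:E =
    - \int[m]_(x in ~` B) (`|a x - b x|)%:E.
  rewrite -integral_ge0N//; apply: eq_integral => x /set_mem/= /negP.
  by rewrite -ltNge => Bx; rewrite ltr0_norm ?subr_lt0// opprK.
by rewrite ic abseN gee0_abs// integral_ge0// => x _; rewrite lee_fin.
Qed.

(** The supremum over partitions is attained at the Hahn decomposition
    [B], [~` B]. *)
Lemma total_variation_norm_real_density :
  total_variation_norm
    (fun E => \int[m]_(x in E) (a x)%:E - \int[m]_(x in E) (b x)%:E) =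
  \int[m]_x (`|a x - b x|)%:E.
Proof.
apply/eqP; rewrite eq_le; apply/andP; split.
  apply: ub_ereal_sup => _ [F [mF tF FT] <-].
  rewrite -FT ge0_integral_bigcup//; last first.
    by rewrite FT; apply/measurable_EFinP; exact: measurableT_comp.
  apply: lee_nneseries => // n _; rewrite intab//.
  have := @le_abse_integral _ _ _ m (F n) (EFin \o (fun x => a x - b x)%R) (mF n).
  by apply; exact/measurable_EFinP/measurable_funTS.
apply: ereal_sup_ubound; exists (fun n => if n is 0%N then B else if n is 1%N then ~` B else set0).
  split.
  - by move=> [|[|n]] //; exact: measurableC.
  - apply/trivIsetP => -[|[|i]] [|[|j]] //= _ _ _; rewrite ?set0I ?setI0//.
      by rewrite setICr.
    by rewrite setICl.
  - rewrite -subTset -(setUv B) => x [Bx|Bx]; first by exists 0%N.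
    by exists 1%N.
rewrite split_abs.
rewrite (@nneseries_split _ _ 0%N 2%N)// eseries0 ?adde0; last first.
  by move=> [|[|n]]//; rewrite !integral_set0 sube0 abse0.
rewrite big_nat_recr//= big_nat1 !intab//; last exact: measurableC.
congr (_ + _); rewrite gee0_abs// integral_ge0// => x Bx.
by rewrite lee_fin subr_ge0.
Qed.

Hypothesis ab : \int[m]_x (a x)%:E = \int[m]_x (b x)%:E.

(** For two densities of equal mass the positive and the negative part of the
    difference have the same integral; so a single set [E] witnesses the whole
    distance, and only indicator functions have to be tested. *)
Lemma real_density_distance_upper_set : exists2 E, measurable E &
  \int[m]_x (`|a x - b x|)%:E =
  2%:E * (\int[m]_(x in E) (a x)%:E - \int[m]_(x in E) (b x)%:E).
Proof.
exists B => //; rewrite split_abs intab//.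
have mCB : measurable (~` B) by exact: measurableC.
have : \int[m]_(x in B) (a x - b x)%:E + \int[m]_(x in ~` B) (a x - b x)%:E = 0.
  rewrite -integral_setU//; last 2 first.
  - by rewrite setUv; exact/measurable_EFinP.
  - exact/disj_setPCl.
  rewrite setUv -intab// ab subee//; exact: integrable_fin_num.
have : \int[m]_(x in B) (a x - b x)%:E \is a fin_num.
  by apply: integrable_fin_num => //; exact: integrableS iab.
have : 0 <= \int[m]_(x in B) (a x - b x)%:E.
  by apply: integral_ge0 => x Bx; rewrite lee_fin subr_ge0.
have : \int[m]_(x in ~` B) (a x - b x)%:E \is a fin_num.
  by apply: integrable_fin_num => //; exact: integrableS iab.
case: (\int[m]_(x in B) _) => // r; case: (\int[m]_(x in ~` B) _) => // s _.
rewrite lee_fin => r0 _ /eqP; rewrite -EFinD eqe => /eqP rs.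
rewrite /abse -EFinD -EFinM; congr EFin.
have -> : s = (- r)%R by lra.
by rewrite normrN ger0_norm//; lra.
Qed.

End real_densities.

Variables a b : T -> \bar R.
Hypotheses (a0 : forall x, 0 <= a x) (b0 : forall x, 0 <= b x).
Hypotheses (ma : measurable_fun [set: T] a) (mb : measurable_fun [set: T] b).
Hypotheses (a1 : \int[m]_x a x = 1) (b1 : \int[m]_x b x = 1).

Lemma integral_fine_density (f : T -> \bar R) E : (forall x, 0 <= f x) ->
  measurable_fun [set: T] f -> \int[m]_x f x < +oo -> measurable E ->
  \int[m]_(x in E) (fine (f x))%:E = \int[m]_(x in E) f x.
Proof.
move=> f0 mf fi mE; apply: ge0_ae_eq_integral => //.
- by apply/measurable_EFinP; apply: measurable_funTS; exact: measurableT_comp.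
- exact: measurable_funTS.
- by move=> x _; rewrite lee_fin fine_ge0.
- apply: filterS (ae_lty_integral f0 mf fi) => x fx _.
  by rewrite fineK// ge0_fin_numE.
Qed.

Lemma integrable_fine_density (f : T -> \bar R) : (forall x, 0 <= f x) ->
  measurable_fun [set: T] f -> \int[m]_x f x < +oo ->
  m.-integrable [set: T] (EFin \o (fine \o f)).
Proof.
move=> f0 mf fi; apply/integrableP; split.
  by apply/measurable_EFinP; exact: measurableT_comp.
under eq_integral do rewrite /= ger0_norm ?fine_ge0//.
by rewrite integral_fine_density.
Qed.

Let ia : m.-integrable [set: T] (EFin \o (fine \o a)).
Proof. by apply: integrable_fine_density => //; rewrite a1 ltry. Qed.

Let ib : m.-integrable [set: T] (EFin \o (fine \o b)).
Proof. by apply: integrable_fine_density => //; rewrite b1 ltry. Qed.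

Let ya : \int[m]_x a x < +oo. Proof. by rewrite a1 ltry. Qed.
Let yb : \int[m]_x b x < +oo. Proof. by rewrite b1 ltry. Qed.

Lemma total_variation_norm_density (nu : set T -> \bar R) :
  (forall E, measurable E -> nu E = \int[m]_(x in E) a x - \int[m]_(x in E) b x) ->
  total_variation_norm nu = \int[m]_x (`|fine (a x) - fine (b x)|)%:E.
Proof.
move=> nuE; rewrite -(total_variation_norm_real_density ia ib).
rewrite /total_variation_norm; congr ereal_sup.
apply: eq_imagel => F [mF _ _]; apply: eq_eseriesr => n _.
by rewrite nuE//= !integral_fine_density.
Qed.

Lemma density_distance_upper_set : exists2 B, measurable B &
  \int[m]_x (`|fine (a x) - fine (b x)|)%:E =
  2%:E * (\int[m]_(x in B) a x - \int[m]_(x in B) b x).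
Proof.
have [|E mE] := real_density_distance_upper_set ia ib.
  by rewrite !integral_fine_density// a1 b1.
by rewrite !integral_fine_density// => ->; exists E.
Qed.

End total_variation.

(** * Almost everywhere convergence along decreasing convex sets *)

Section midpoint_convex.
Local Open Scope ereal_scope.
Context d (T : measurableType d) (R : realType).
Variables (m : {measure set T -> \bar R}) (F : T -> \bar R).
Hypotheses (F0 : forall x, 0 < F x) (mF : measurable_fun [set: T] F)
  (Foo : \int[m]_x F x < +oo).

Let energy (u : T -> R) : \bar R := \int[m]_x (F x * ((u x) ^+ 2)%:E).

Let mFu (u : T -> R) : measurable_fun [set: T] u ->
  measurable_fun [set: T] (fun x => F x * ((u x) ^+ 2)%:E).
Proof.
by move=> mu; apply: emeasurable_funM => //; apply/measurable_EFinP/measurable_funX.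
Qed.

Let Fu0 (u : T -> R) x : 0 <= F x * ((u x) ^+ 2)%:E.
Proof. by rewrite mule_ge0 ?lee_fin ?sqr_ge0// ltW. Qed.

Let F00 x : 0 <= F x. Proof. exact: ltW. Qed.

Let Ffin : \int[m]_x F x \is a fin_num.
Proof. by rewrite ge0_fin_numE// integral_ge0. Qed.

Let energy_ge0 w : 0 <= energy w.
Proof. by apply: integral_ge0 => x _; exact: (Fu0 w). Qed.

Let intFD (p q : T -> R) : (forall x, 0 <= p x)%R -> (forall x, 0 <= q x)%R ->
  measurable_fun [set: T] p -> measurable_fun [set: T] q ->
  \int[m]_x (F x * (p x)%:E) + \int[m]_x (F x * (q x)%:E) =
  \int[m]_x (F x * (p x + q x)%:E).
Proof.
move=> p0 q0 mp mq; rewrite -ge0_integralD//.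
- by apply: eq_integral => x _; rewrite EFinD ge0_muleDr ?lee_fin.
- by move=> x _; rewrite mule_ge0 ?lee_fin.
- by apply: emeasurable_funM => //; exact/measurable_EFinP.
- by move=> x _; rewrite mule_ge0 ?lee_fin.
- by apply: emeasurable_funM => //; exact/measurable_EFinP.
Qed.

Let energyZ (c : R) (u : T -> R) : (0 <= c)%R -> measurable_fun [set: T] u ->
  c%:E * energy u = \int[m]_x (F x * (c * (u x) ^+ 2)%:E).
Proof.
move=> c0 mu; rewrite -ge0_integralZl//; last exact: mFu.
by apply: eq_integral => x _; rewrite EFinM muleCA.
Qed.

Let parallelogram (u v : T -> R) :
  measurable_fun [set: T] u -> measurable_fun [set: T] v ->
  energy (fun x => (u x + v x) / 2)%R + (1 / 4)%:E * energy (fun x => u x - v x)%R =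
  (1 / 2)%:E * energy u + (1 / 2)%:E * energy v.
Proof.
move=> mu mv.
have muv : measurable_fun [set: T] (fun x => u x - v x)%R by exact: measurable_funB.
have mD : measurable_fun [set: T] (fun x => (u x + v x) / 2)%R.
  by apply: measurable_funM => //; exact: measurable_funD.
have mX c (w : T -> R) : measurable_fun [set: T] w ->
    measurable_fun [set: T] (fun x => c * (w x) ^+ 2)%R.
  by move=> mw; apply: measurable_funM => //; exact: measurable_funX.
rewrite !energyZ// /energy intFD; last 4 first.
- by move=> x; exact: sqr_ge0.
- by move=> x; rewrite mulr_ge0// sqr_ge0.
- exact: measurable_funX.
- exact: mX.
rewrite intFD; last 4 first.
- by move=> x; rewrite mulr_ge0// sqr_ge0.
- by move=> x; rewrite mulr_ge0// sqr_ge0.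
- exact: mX.
- exact: mX.
by apply: eq_integral => x _; congr (_ * _%:E); field.
Qed.

Variable C : nat -> set (T -> R).
Hypothesis C_unit : forall n u, C n u ->
  measurable_fun [set: T] u /\ forall x, (0 <= u x <= 1)%R.
Hypothesis C_mid : forall n u v, C n u -> C n v -> C n (fun x => (u x + v x) / 2)%R.
Hypothesis C_decr : forall k n, (k <= n)%N -> C n `<=` C k.
Hypothesis C_ne : forall n, C n !=set0.

Let energy_le (u : T -> R) n : C n u -> energy u <= \int[m]_x F x.
Proof.
move=> /C_unit[mu u01]; apply: ge0_le_integral => //; first exact: mFu.
move=> x _; rewrite -[leRHS]mule1 lee_wpmul2l// lee_fin.
by have /andP[u0 u1] := u01 x; rewrite exprn_ile1.
Qed.

Let energy_fin u n : C n u -> energy u \is a fin_num.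
Proof.
move=> Cu; rewrite ge0_fin_numE; last by apply: integral_ge0 => x _.
exact: le_lt_trans (energy_le Cu) _.
Qed.

Let inf_energy n : R := inf [set fine (energy u) | u in C n].

Let lb n : has_lbound [set fine (energy u) | u in C n].
Proof.
by exists 0%R => _ [u Cu <-]; rewrite fine_ge0//; apply: integral_ge0 => x _.
Qed.

Let inf_energy_le n u : C n u -> (inf_energy n <= fine (energy u))%R.
Proof. by move=> Cu; apply: ge_inf => //; exists u. Qed.

Let top := sup (range inf_energy).

Let inf_energy_top n : (inf_energy n <= top)%R.
Proof.
apply: ub_le_sup; last by exists n.
exists (fine (\int[m]_x F x)) => _ [k _ <-].
have [u Cu] := C_ne k; apply: le_trans (inf_energy_le Cu) _.
by rewrite fine_le//; [exact: energy_fin Cu|exact: energy_le Cu].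
Qed.

Let eps j : R := ((1 / 4) ^+ j)%R.

Let eps0 j : (0 < eps j)%R. Proof. by rewrite exprn_gt0. Qed.

(** The index may exceed [j]: it is taken so large that the infimum over the
    set has almost reached its limit [top]. *)
Let almost_minimal j : exists Nu : nat * (T -> R),
  [/\ (j <= Nu.1)%N, C Nu.1 Nu.2, (top - eps j <= inf_energy Nu.1)%R &
      (fine (energy Nu.2) <= top + eps j)%R].
Proof.
have inf_nd k n : (k <= n)%N -> (inf_energy k <= inf_energy n)%R.
  move=> kn; apply: lb_le_inf; first by have [u Cu] := C_ne n; exists (fine (energy u)), u.
  by move=> _ [u /(C_decr kn) Cu <-]; exact: inf_energy_le.
have [|_ [k _ <-] hk] := @sup_adherent _ (range inf_energy) _ (eps0 j).
  split; first by exists (inf_energy 0%N), 0%N.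
  by exists top => _ [n _ <-].
pose N := maxn j k.
have [|_ [u Cu <-] hu] := @inf_adherent _ [set fine (energy u) | u in C N] _ (eps0 j).
  by split => //; have [u Cu] := C_ne N; exists (fine (energy u)), u.
exists (N, u); split => //=.
- by rewrite leq_maxl.
- by rewrite (le_trans (ltW hk))// inf_nd// leq_maxr.
- by rewrite (le_trans (ltW hu))// lerD2r; exact: inf_energy_top.
Qed.

(** A substitute for weak compactness.  Choose almost minimal elements for the
    weighted L2 norm in the sets [C n]: since midpoints stay in these sets, the
    parallelogram law makes consecutive choices close, and a fast choice
    converges almost everywhere. *)
Lemma midpoint_convex_ae_cvg : exists u : nat -> T -> R,
  (forall n, C n (u n)) /\ {ae m, forall x, cvgn (u ^~ x)}.
Proof.
have [Nu hNu] := choice almost_minimal.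
pose u j := (Nu j).2; pose N j := (Nu j).1.
have Cu j : C (N j) (u j) by have [] := hNu j.
have mu j : measurable_fun [set: T] (u j) by have [] := C_unit (Cu j).
exists u; split; first by move=> n; apply: (@C_decr n (N n)) => //; have [] := hNu n.
have eps_decr j : (eps j.+1 <= eps j)%R.
  by rewrite /eps exprSr ler_piMr ?exprn_ge0//; lra.
have dist j : energy (fun x => u j.+1 x - u j x)%R <= (8 * eps j)%:E.
  pose M := minn (N j.+1) (N j).
  have Cmid : C M (fun x => (u j.+1 x + u j x) / 2)%R.
    apply: C_mid; [apply: (C_decr (geq_minl _ _))|apply: (C_decr (geq_minr _ _))];
    exact: Cu.
  have := parallelogram (mu j.+1) (mu j).
  have e0 : 0 <= energy (fun x => u j.+1 x - u j x)%R by exact: energy_ge0.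
  have topM : (top - eps j <= inf_energy M)%R.
    rewrite /M; have [_ _ h1 _] := hNu j; have [_ _ h2 _] := hNu j.+1.
    case: leqP => _; last exact: h1.
    by apply: le_trans h2; rewrite lerB.
  have := inf_energy_le Cmid.
  have [_ _ _ ub0] := hNu j; have [_ _ _ ub1] := hNu j.+1.
  have := energy_fin Cmid; have := energy_fin (Cu j); have := energy_fin (Cu j.+1).
  move: ub0 ub1; rewrite -/(u j) -/(u j.+1); have := eps_decr j.
  case: (energy (u j)) => // p; case: (energy (u j.+1)) => // q.
  case: (energy (fun x => (_ + _) / 2)%R) => // r.
  move: e0; case: (energy (fun x => _ - _)%R) => [s|_|//]; last first.
    by rewrite gt0_muley ?lte_fin//; lra.
  rewrite /= lee_fin => s0 h0 h1 h2 _ _ _ h3.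
  by rewrite -!EFinM -!EFinD => -[h4]; rewrite lee_fin; lra.
have mw j : measurable_fun [set: T] (fun x => (`|u j.+1 x - u j x|)%:E).
  by apply/measurable_EFinP/measurableT_comp => //; exact: measurable_funB.
have : {ae m, forall x, \sum_(j <oo) (`|u j.+1 x - u j x|)%:E < +oo}.
  apply: (@ae_weighted_summable _ _ _ m F (fun j x => (`|u j.+1 x - u j x|)%:E)) => //.
  pose K := (2 * (fine (\int[m]_x F x) + 8))%R.
  have K0 : (0 <= K)%R.
    by rewrite mulr_ge0// addr_ge0// fine_ge0// integral_ge0.
  apply: (@le_lt_trans _ _ (\sum_(j <oo) (K%:E * ((1 - 1 / 2) * (1 / 2) ^+ j)%:E))).
    apply: lee_nneseries => [j _ _|j _].
      by apply: integral_ge0 => x _; rewrite mule_ge0.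
    (* [|w| <= t + w^2 / t] with [t = 2^-j] turns the L2 bound of order [t^2]
       into an L1 bound of order [t]. *)
    pose t : R := ((1 / 2) ^+ j)%R.
    have t0 : (0 < t)%R by rewrite exprn_gt0.
    have t2 : eps j = (t ^+ 2)%R by rewrite /eps -exprM mulnC exprM; congr (_ ^+ _)%R; field.
    have tV0 : (0 <= t^-1)%R by rewrite invr_ge0 ltW.
    pose w x := (u j.+1 x - u j x)%R.
    have mw' : measurable_fun [set: T] w by exact: measurable_funB.
    apply: (@le_trans _ _ (t%:E * \int[m]_x F x + (t^-1)%:E * energy w)).
      rewrite -ge0_integralZl//; last by rewrite lee_fin ltW.
      rewrite energyZ// -ge0_integralD//=.
      - apply: ge0_le_integral => //.
        + by move=> x _; rewrite mule_ge0.
        + exact: emeasurable_funM.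
        + apply: emeasurable_funD; first exact: measurable_funeM.
          apply: emeasurable_funM => //; apply/measurable_EFinP.
          by apply: measurable_funM => //; exact: measurable_funX.
        move=> x _; rewrite [t%:E * _]muleC -ge0_muleDr ?lee_fin//; last 2 first.
        + exact: ltW.
        + by rewrite mulr_ge0// sqr_ge0.
        rewrite lee_wpmul2l// -EFinD lee_fin -/(w x).
        rewrite -(ler_pM2l t0) mulrDr mulrA divff ?gt_eqF// mul1r.
        have := sqr_ge0 (t - `|w x|)%R; have := real_normK (num_real (w x)).
        by have := sqr_ge0 (t + `|w x|)%R; nra.
      - by move=> x _; rewrite mule_ge0// lee_fin ltW.
      - exact: measurable_funeM.
      - by move=> x _; rewrite mule_ge0// lee_fin mulr_ge0// sqr_ge0.
      - apply: emeasurable_funM => //; apply/measurable_EFinP.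
        by apply: measurable_funM => //; exact: measurable_funX.
    have := dist j; rewrite -/w t2.
    have : 0 <= energy w by exact: energy_ge0.
    rewrite -[\int[m]_x F x]fineK//; case: (energy w) => // s.
    rewrite lee_fin => s0; rewrite lee_fin => s8; rewrite -!EFinM -EFinD lee_fin -/t /K.
    have : (t^-1 * s <= 8 * t)%R by rewrite ler_pdivrMl// mulrCA.
    by lra.
  rewrite nneseriesZl; last by move=> n _; rewrite lee_fin mulr_ge0 ?exprn_ge0//; lra.
  by rewrite eseries_geometric ?mule1 ?ltry//; lra.
by apply: filterS => x; exact: (@cvg_abs_summable R (u ^~ x)).
Qed.

End midpoint_convex.

(** * Measurability in a Borel groupoid *)

Local Notation gcomp := Defs.comp.

Lemma measure_mono d (T : measurableType d) (R : realType)
    (m : {measure set T -> \bar R}) (A B : set T) :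
  measurable A -> measurable B -> A `<=` B -> (m A <= m B)%E.
Proof. by move=> mA mB AB; apply: le_measure => //; exact: mem_set. Qed.

Section analytic_diagonal.
Context (R : realType) d (X : measurableType d).

(** Points of an analytic Borel space are separated by countably many Borel
    sets, here the preimages of balls with centre in a countable dense set. *)
Lemma measurable_diagonal : analytic_borel_space R X ->
  measurable [set p : X * X | p.1 = p.2].
Proof.
move=> [P [phi [[hP [S cS dS]] _ phi_inj mX]]].
pose r n : R := n.+1%:R^-1.
have r0 n : 0 < r n by rewrite invr_gt0.
pose U (s : P) n := phi @^-1` (ball s (r n + r n))°.
have mU s n : measurable (U s n).
  apply/mX; exists (ball s (r n + r n))° => //.
  by apply: sub_sigma_algebra; exact: open_interior.
have -> : [set p : X * X | p.1 = p.2] =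
    ~` \bigcup_(n in [set: nat]) \bigcup_(s in S) (U s n `*` ~` U s n).
  apply/seteqP; split => [[x y] /= <- [n _ [s _ [/= Ux nUx]]]|[x y] /= h] //.
  apply: contrapT => xy; apply: h.
  have /existsNP[A /not_implyP[nA]] : ~ (forall A, nbhs (phi x) A -> A (phi y)).
    move=> h; apply: xy; apply: phi_inj; apply: hP => A B nA nB.
    by exists (phi y); split; [exact: h|exact: nbhs_singleton].
  move: nA => /nbhs_ballP[e /= e0 eA] nAy.
  pose n := Num.truncn (3 / e).
  have rn : r n + r n + r n <= e.
    have : 3 / e < n.+1%:R by exact: truncnS_gt.
    rewrite ltr_pdivrMr// => h.
    have -> : r n + r n + r n = 3 / n.+1%:R by rewrite /r -mulr_natl; ring.
    by rewrite ler_pdivrMr// mulrC ltW.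
  exists n => //.
  have [|s [/interior_subset xs Ss]] := dS (ball (phi x) (r n))° _ (@open_interior _ _).
    by exists (phi x); exact/nbhsx_ballx/r0.
  exists s => //; split => /=.
    apply/nbhs_ballP; exists (r n) => //= z xz.
    by apply: ball_triangle xz; exact: ball_sym.
  move=> /interior_subset sy; apply: nAy; apply: eA.
  apply: (@le_ball _ _ _ (r n + (r n + r n))); first by rewrite addrA.
  exact: ball_triangle xs sy.
apply: measurableC; apply: bigcup_measurable => n _.
rewrite bigcup_set_type; apply: countable_bigcupT_measurable.
  by rewrite (eq_countable (card_setT _)).
move=> s.
by apply: measurableX => //; exact: measurableC.
Qed.

End analytic_diagonal.

Section groupoid_measurability.
Import HBNNSimple.
Local Open Scope ereal_scope.
Context (R : realType) (dX dG : measure_display)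
  (X : measurableType dX) (G : measurableType dG) (Gd : groupoid X G).
Hypothesis bG : borel_groupoid R Gd.

Lemma measurable_src : measurable_fun [set: G] (src Gd).
Proof. by case: bG => _ [_ [_ []]]. Qed.

Lemma measurable_tgt : measurable_fun [set: G] (tgt Gd).
Proof. by case: bG => _ [_ [_ [_ []]]]. Qed.

Lemma measurable_unit_arrow : measurable_fun [set: X] (unit_arrow Gd).
Proof.
by move=> _ E mE; rewrite setTI; case: bG => _ [_ [h _]]; apply/h; exists E.
Qed.

Lemma measurable_composable : measurable (composable Gd).
Proof.
have mD := measurable_diagonal bG.2.1.
rewrite [composable Gd](_ : _ = [set: G * G] `&`
  (fun p : G * G => (src Gd p.1, tgt Gd p.2)) @^-1` [set p : X * X | p.1 = p.2]).
  suff : measurable_fun [set: G * G] (fun p : G * G => (src Gd p.1, tgt Gd p.2)) by exact.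
  apply/measurable_fun_pair.
    by apply: measurableT_comp; [exact: measurable_src|exact: measurable_fst].
  by apply: measurableT_comp; [exact: measurable_tgt|exact: measurable_snd].
by rewrite setTI.
Qed.

Lemma measurable_fibre x : measurable (fibre Gd x).
Proof.
have mD := measurable_diagonal bG.2.1.
rewrite [fibre Gd x](_ : _ = [set: G] `&`
  (fun g => (tgt Gd g, x)) @^-1` [set p : X * X | p.1 = p.2]).
  suff : measurable_fun [set: G] (fun g => (tgt Gd g, x)) by exact.
  by apply/measurable_fun_pair; [exact: measurable_tgt|exact: measurable_cst].
by rewrite setTI.
Qed.

(** The composition is only assumed Borel on the set of composable pairs, which
    is itself Borel because the diagonal of the objects is. *)
Lemma measurable_left_mul g : measurable_fun (fibre Gd (src Gd g)) (gcomp Gd g).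
Proof.
move=> _ E mE.
have [_ [_ [_ [_ [_ mc]]]]] := bG.
rewrite [X in measurable X](_ : _ = [set: G] `&` (fun h => (g, h)) @^-1`
   (composable Gd `&` (fun p : G * G => gcomp Gd p.1 p.2) @^-1` E)); last first.
  rewrite setTI; apply/seteqP; split => h /= [].
    by rewrite /fibre /composable/= => -> ?; split.
  by rewrite /fibre /composable/= => -> ?; split.
suff : measurable_fun [set: G] (fun h : G => (g, h)).
  by apply => //; exact: (mc measurable_composable).
by apply/measurable_fun_pair; [exact: measurable_cst|exact: measurable_id].
Qed.

(** The value 0 off the fibre makes this a Borel function on all arrows, although
    [comp] is unconstrained at pairs that are not composable. *)
Definition left_shift (g : G) (u : G -> \bar R) : G -> \bar R :=
  (fun h => u (gcomp Gd g h)) \_ (fibre Gd (src Gd g)).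

Lemma left_shift_ge0 g u : (forall h, 0 <= u h) -> forall h, 0 <= left_shift g u h.
Proof. by move=> u0 h; rewrite /left_shift patchE; case: ifP. Qed.

Lemma left_shiftE g u h : src Gd g = tgt Gd h -> left_shift g u h = u (gcomp Gd g h).
Proof. by move=> gh; rewrite /left_shift patchE mem_set. Qed.

Lemma measurable_left_shift g u : measurable_fun [set: G] u ->
  measurable_fun [set: G] (left_shift g u).
Proof.
move=> mu; apply/measurable_restrict => //; first exact: measurable_fibre.
rewrite setTI; apply: measurableT_comp mu _.
exact: measurable_left_mul.
Qed.

Variable lam : borel_system R Gd.
Hypothesis lam_proper : proper_system lam.

(** Properness enters here: on each set [A n] the kernel [lam] is finite, so the
    measures of sections are measurable there, and the sets [A n] exhaust [G]. *)
Lemma measurable_kernel_integral d' (Y : measurableType d') (f : Y -> X)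
    (F : Y * G -> \bar R) : measurable_fun [set: Y] f ->
  (forall p, 0 <= F p) -> measurable_fun [set: Y * G] F ->
  measurable_fun [set: Y] (fun y => \int[lam (f y)]_h F (y, h)).
Proof.
move=> mf F0 mF.
have [A [mA ndA AT Afin]] := lam_proper.
pose l y : {measure set G -> \bar R} := lam (f y).
have ml U : measurable U -> measurable_fun [set: Y] (l ^~ U).
  move=> mU; exact: measurableT_comp (system_measurable lam mU) mf.
pose H := isKernel.Build _ _ Y G R l ml.
pose k : R.-ker Y ~> G := HB.pack_for (kernel Y G R) l H.
pose F_ := nnsfun_approx measurableT mF.
apply: (measurable_fun_xsection_integral F l F_).
- by move=> a b ab; exact/nd_nnsfun_approx.
- by move=> z; exact/cvg_nnsfun_approx.
move=> n r; set B := _ @^-1` _.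
have mB : measurable B by exact: measurable_sfunP.
rewrite (_ : (fun y => _) = (fun y => limn_esup (fun n => l y (xsection B y `&` A n)))).
  apply: measurable_fun_limn_esup => j.
  have [] // := @measurable_prod_subset_xsection_kernel _ _ Y G R k (A j) (mA j) _ B mB.
  move=> y; have [M hM] := Afin j; exists (M + 1)%R => U mU.
  rewrite /mrestr/=; apply: (@le_lt_trans _ _ (lam (f y) (A j))).
    by apply: measure_mono => //; exact: measurableI.
  by rewrite (le_lt_trans (hM _))// lte_fin ltrDl.
apply/funext => y; rewrite is_cvg_limn_esupE.
  apply/esym/cvg_lim => //.
  have -> : l y (xsection B y) = l y (\bigcup_j (xsection B y `&` A j)).
    by rewrite -setI_bigcupr AT setIT.
  apply: nondecreasing_cvg_mu.
  - by move=> j; apply: measurableI => //; exact: measurable_xsection.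
  - apply: bigcup_measurable => j _.
    by apply: measurableI => //; exact: measurable_xsection.
  - by move=> i j ij; apply/subsetPset; apply: setIS; exact/subsetPset/ndA.
apply: ereal_nondecreasing_is_cvgn => i j ij.
apply: measure_mono.
- by apply: measurableI => //; exact: measurable_xsection.
- by apply: measurableI => //; exact: measurable_xsection.
- by apply: setIS; exact/subsetPset/ndA.
Qed.

Lemma measurable_system_integral (u : G -> \bar R) : (forall h, 0 <= u h) ->
  measurable_fun [set: G] u -> measurable_fun [set: X] (fun x => \int[lam x]_h u h).
Proof. by move=> u0 mu; exact: system_borel. Qed.

Lemma integral_fibre x (u v : G -> \bar R) :
  measurable_fun [set: G] u -> measurable_fun [set: G] v ->
  (forall h, tgt Gd h = x -> u h = v h) -> \int[lam x]_h u h = \int[lam x]_h v h.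
Proof.
move=> mu mv uv; apply: ae_eq_integral => //.
exists (~` fibre Gd x); split; first by apply: measurableC; exact: measurable_fibre.
  exact: system_fibre.
by move=> h /= /not_implyP[_ ne] hx; apply: ne; exact: uv.
Qed.

Variable mu : {measure set X -> \bar R}.

Lemma integral_star (u : G -> \bar R) : (forall h, 0 <= u h) ->
  measurable_fun [set: G] u ->
  \int[star mu lam]_h u h = \int[mu]_x \int[lam x]_h u h.
Proof.
move: u; apply: ge0_measurable_ind.
- move=> E mE; rewrite integral_indic// setIT /star.
  by apply: eq_integral => x _; rewrite integral_indic// setIT.
- move=> f g f0 g0 mf mg hf hg.
  have -> : \int[star mu lam]_h (f h + g h) =
      \int[star mu lam]_h f h + \int[star mu lam]_h g h by exact: ge0_integralD.
  rewrite hf hg.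
  have -> : \int[mu]_x \int[lam x]_h (f h + g h) =
      \int[mu]_x (\int[lam x]_h f h + \int[lam x]_h g h).
    by apply: eq_integral => x _; rewrite ge0_integralD.
  apply/esym/ge0_integralD => //.
  + by move=> x _; exact: integral_ge0.
  + exact: measurable_system_integral.
  + by move=> x _; exact: integral_ge0.
  + exact: measurable_system_integral.
- move=> c f c0 f0 mf hf; rewrite (@ge0_integralZl _ _ _ (star mu lam))// hf.
  have -> : \int[mu]_x \int[lam x]_h (c%:E * f h) =
      \int[mu]_x (c%:E * \int[lam x]_h f h).
    by apply: eq_integral => x _; rewrite ge0_integralZl.
  apply/esym/ge0_integralZl => //.
  + exact: measurable_system_integral.
  + by move=> x _; exact: integral_ge0.
- move=> f f0 mf ndf hf.
  rewrite monotone_convergence//.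
  rewrite (_ : (fun n => \int[star mu lam]_x f n x) =
    (fun n => \int[mu]_x \int[lam x]_h f n h)); last by apply/funext.
  rewrite -(@monotone_convergence _ _ _ mu)//.
  + apply: eq_integral => x _; by rewrite monotone_convergence.
  + by move=> n; exact: measurable_system_integral.
  + by move=> n x _; exact: integral_ge0.
  + move=> x _ i j ij; apply: ge0_le_integral => //.
    by move=> h _; exact: (ndf h i j ij).
Qed.

(** The sets [A n] of properness have bounded fibre measures; cut them down to
    the fibres over sets of finite [mu]-measure. *)
Lemma star_sigma_finite : sigma_finite [set: X] mu ->
  sigma_finite [set: G] (star mu lam).
Proof.
move=> /sigma_finiteP[B [BT ndB Bfin]]; have [A [mA ndA AT Afin]] := lam_proper.
have mB n : measurable (B n) by case: (Bfin n).
have mtB n : measurable (tgt Gd @^-1` B n).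
  by rewrite -[X in measurable X]setTI; exact: measurable_tgt.
exists (fun n => A n `&` tgt Gd @^-1` B n).
  apply/esym; rewrite -subTset => g _.
  have [i _ Ag] : (\bigcup_n A n) g by rewrite AT.
  have [j _ Bg] : (\bigcup_n B n) (tgt Gd g) by rewrite -BT.
  exists (maxn i j) => //; split.
    by move: g Ag {Bg}; exact/subsetPset/ndA/leq_maxl.
  by rewrite /preimage/=; move: Bg; exact/subsetPset/ndB/leq_maxr.
move=> n; split; first exact: measurableI.
have [M hM] := Afin n.
pose c := Num.max M 0%R.
apply: (@le_lt_trans _ _ (\int[mu]_x (c%:E * (\1_(B n) x)%:E))).
  apply: ge0_le_integral => //.
  - by apply: system_measurable; exact: measurableI.
  - by apply: measurable_funeM; apply/measurable_EFinP; exact: measurable_indic.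
  move=> x _; rewrite indicE; have [xB|xB] := boolP (x \in B n).
    rewrite mule1 (@le_trans _ _ (lam x (A n)))//; last first.
      by rewrite (le_trans (hM x))// lee_fin le_max lexx.
    by apply: measure_mono => //; exact: measurableI.
  rewrite mule0 -(system_fibre lam x); apply: measure_mono.
  - exact: measurableI.
  - by apply: measurableC; exact: measurable_fibre.
  - by move=> g [_ /= tB] tx; move: xB; rewrite -tx mem_set.
rewrite ge0_integralZl//; last 2 first.
- by apply/measurable_EFinP; exact: measurable_indic.
- by rewrite lee_fin le_max lexx orbT.
rewrite integral_indic// setIT; have [_ Boo] := Bfin n.
by rewrite -[mu (B n)]fineK ?ge0_fin_numE// -EFinM ltry.
Qed.

End groupoid_measurability.

Lemma nneseriesZl_ge0 (R : realType) (f : (\bar R)^nat) (y : \bar R) :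
  (0 <= y)%E -> (forall j, 0 <= f j)%E ->
  (\sum_(j <oo) (y * f j) = y * \sum_(j <oo) f j)%E.
Proof.
move=> y0 f0; rewrite -!ge0_integral_count//; last by move=> j; rewrite mule_ge0.
by rewrite ge0_integralZl.
Qed.

Lemma limeMl_ge0 (R : realType) (u : (\bar R)^nat) (y : \bar R) :
  (0 <= y)%E -> (forall n, 0 <= u n)%E -> nondecreasing_seq u ->
  (limn (fun n => y * u n) = y * limn u)%E.
Proof.
move=> y0 u0 ndu; have cu := ereal_nondecreasing_is_cvgn ndu.
case: y y0 => [y _|_|//]; first by rewrite limeMl.
have [uall|/existsNP[k uk]] := pselect (forall n, u n = 0%E).
  have -> : u = cst 0%E by exact/funext.
  by under eq_fun do rewrite mule0; rewrite !lim_cst// mule0.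
have uk0 : (0 < u k)%E by rewrite lt_neqAle u0 andbT; apply/eqP => h; exact: uk.
rewrite gt0_mulye; last first.
  apply: lt_le_trans uk0 _; rewrite (cvg_lim _ (ereal_nondecreasing_cvgn ndu))//.
  by apply: ereal_sup_ubound; exists k.
apply: lim_near_cst => //; exists k => // n /= kn.
by rewrite gt0_mulye// (lt_le_trans uk0)// ndu.
Qed.

(** * Kernels on the fibres and adapted systems *)

Section density_measure.
Local Open Scope ereal_scope.
Context d (T : measurableType d) (R : realType).
Variables (m : {measure set T -> \bar R}) (f : T -> \bar R).
Hypotheses (f0 : forall x, 0 <= f x) (mf : measurable_fun [set: T] f).

(** The two hypotheses are arguments so that the measure structure, whose axioms
    depend on them, can be attached to the definition. *)
Definition density_measure (f0 : forall x, 0 <= f x)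
  (mf : measurable_fun [set: T] f) (E : set T) : \bar R := \int[m]_(x in E) f x.

Local Notation nu := (density_measure f0 mf).

Let nu0 : nu set0 = 0. Proof. exact: integral_set0. Qed.

Let nu_ge0 E : 0 <= nu E. Proof. by apply: integral_ge0 => x _. Qed.

Let nu_sigma_additive : semi_sigma_additive nu.
Proof.
move=> F mF tF mFF; rewrite /density_measure ge0_integral_bigcup//; last first.
  exact: measurable_funTS.
by apply: is_cvg_nneseries => n _ _; exact: integral_ge0.
Qed.

HB.instance Definition _ := isMeasure.Build _ _ _ nu nu0 nu_ge0 nu_sigma_additive.

Lemma integral_density_measure (u : T -> \bar R) : (forall x, 0 <= u x) ->
  measurable_fun [set: T] u -> \int[nu]_x u x = \int[m]_x (f x * u x).
Proof.
move: u; apply: ge0_measurable_ind.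
- move=> E mE; rewrite integral_indic// setIT /density_measure [LHS]integral_mkcond.
  by apply: eq_integral => x _; rewrite patchE indicE; case: ifP; rewrite ?mule1 ?mule0.
- move=> u v u0 v0 mu mv hu hv; rewrite ge0_integralD// hu hv -ge0_integralD//.
  + by apply: eq_integral => x _; rewrite ge0_muleDr.
  + by move=> x _; rewrite mule_ge0.
  + exact: emeasurable_funM.
  + by move=> x _; rewrite mule_ge0.
  + exact: emeasurable_funM.
- move=> c u c0 u0 mu hu; rewrite ge0_integralZl// hu -ge0_integralZl//.
  + by apply: eq_integral => x _; rewrite muleCA.
  + exact: emeasurable_funM.
  + by move=> x _; rewrite mule_ge0.
- move=> u u0 mu ndu hu; rewrite monotone_convergence//.
  rewrite (_ : (fun n => \int[nu]_x u n x) = (fun n => \int[m]_x (f x * u n x))); last first.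
    exact/funext.
  rewrite -monotone_convergence//.
  + apply: eq_integral => x _; rewrite limeMl_ge0//.
  + by move=> n; exact: emeasurable_funM.
  + by move=> n x _; rewrite mule_ge0.
  + by move=> x _ i j ij; rewrite lee_wpmul2l// ndu.
Qed.

End density_measure.

Section densities.
Local Open Scope ereal_scope.
Context (R : realType) (dX dG : measure_display)
  (X : measurableType dX) (G : measurableType dG) (Gd : groupoid X G).
Hypothesis bG : borel_groupoid R Gd.
Variable lam : borel_system R Gd.
Hypothesis lam_proper : proper_system lam.

Implicit Types (t : G * G -> \bar R) (u v : G -> \bar R).

(** For the density [t] of the translates of [theta] this is the Markov operator:
    the integral of [u (g h)] over [theta^(src g)] in [h] ([represents]). *)
Definition act t u (g : G) : \bar R := \int[lam (tgt Gd g)]_h (t (g, h) * u h).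

Lemma act_ge0 t u g : (forall p, 0 <= t p) -> (forall h, 0 <= u h) -> 0 <= act t u g.
Proof. by move=> t0 u0; apply: integral_ge0 => h _; rewrite mule_ge0. Qed.

Lemma measurable_section t g : measurable_fun [set: G * G] t ->
  measurable_fun [set: G] (fun h => t (g, h)).
Proof.
move=> mt; apply: measurableT_comp mt _.
by apply/measurable_fun_pair; [exact: measurable_cst|exact: measurable_id].
Qed.

Lemma measurable_cosection t h : measurable_fun [set: G * G] t ->
  measurable_fun [set: G] (fun g => t (g, h)).
Proof.
move=> mt; apply: measurableT_comp mt _.
by apply/measurable_fun_pair; [exact: measurable_id|exact: measurable_cst].
Qed.

Lemma measurable_sectionM t u g : measurable_fun [set: G * G] t ->
  measurable_fun [set: G] u -> measurable_fun [set: G] (fun h => t (g, h) * u h).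
Proof. by move=> mt mu; apply: emeasurable_funM => //; exact: measurable_section. Qed.

Lemma measurable_act t u : (forall p, 0 <= t p) -> measurable_fun [set: G * G] t ->
  (forall h, 0 <= u h) -> measurable_fun [set: G] u -> measurable_fun [set: G] (act t u).
Proof.
move=> t0 mt u0 mu.
apply: (measurable_kernel_integral lam_proper (F := fun p => t p * u p.2)).
- exact: (measurable_tgt bG).
- by move=> p; rewrite mule_ge0.
- apply: emeasurable_funM => //; exact: measurableT_comp mu measurable_snd.
Qed.

Lemma act_indic t E g : measurable E ->
  act t (fun h => (\1_E h)%:E) g = \int[lam (tgt Gd g)]_(h in E) t (g, h).
Proof.
move=> mE; rewrite integral_mkcond.
by apply: eq_integral => h _; rewrite patchE indicE; case: ifP; rewrite ?mule1 ?mule0.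
Qed.

Lemma actD t u v g : (forall p, 0 <= t p) -> measurable_fun [set: G * G] t ->
  (forall h, 0 <= u h) -> measurable_fun [set: G] u ->
  (forall h, 0 <= v h) -> measurable_fun [set: G] v ->
  act t (fun h => u h + v h) g = act t u g + act t v g.
Proof.
move=> t0 mt u0 mu v0 mv; rewrite /act -ge0_integralD//.
- by apply: eq_integral => h _; rewrite ge0_muleDr.
- by move=> h _; rewrite mule_ge0.
- exact: measurable_sectionM.
- by move=> h _; rewrite mule_ge0.
- exact: measurable_sectionM.
Qed.

Lemma actZ t u (c : R) g : (0 <= c)%R ->
  (forall p, 0 <= t p) -> measurable_fun [set: G * G] t ->
  (forall h, 0 <= u h) -> measurable_fun [set: G] u ->
  act t (fun h => c%:E * u h) g = c%:E * act t u g.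
Proof.
move=> c0 t0 mt u0 mu; rewrite /act -ge0_integralZl//.
- by apply: eq_integral => h _; rewrite muleCA.
- exact: measurable_sectionM.
- by move=> h _; rewrite mule_ge0.
Qed.

Lemma act_fibre t u v g : measurable_fun [set: G * G] t ->
  measurable_fun [set: G] u -> measurable_fun [set: G] v ->
  (forall h, tgt Gd h = tgt Gd g -> u h = v h) -> act t u g = act t v g.
Proof.
move=> mt mu mv uv; apply: (integral_fibre bG) => [||h /uv ->//];
  exact: measurable_sectionM.
Qed.

Lemma le_act t u v g : (forall p, 0 <= t p) -> measurable_fun [set: G * G] t ->
  (forall h, 0 <= u h) -> measurable_fun [set: G] u ->
  (forall h, 0 <= v h) -> measurable_fun [set: G] v ->
  {ae lam (tgt Gd g), forall h, u h <= v h} -> act t u g <= act t v g.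
Proof.
move=> t0 mt u0 mu v0 mv uv; apply: ae_ge0_le_integral => //.
- by move=> h _; rewrite mule_ge0.
- exact: measurable_sectionM.
- by move=> h _; rewrite mule_ge0.
- exact: measurable_sectionM.
- by apply: filterS uv => h uvh _; rewrite lee_wpmul2l.
Qed.

(** The last clause says that the measure with density [t (g h, -)] is the
    translate by [g] of the measure with density [t (h, -)]. *)
Definition transition t : Prop :=
  [/\ forall p, 0 <= t p, measurable_fun [set: G * G] t,
      forall g, act t (cst 1) g = 1 &
      forall g h u, src Gd g = tgt Gd h -> (forall k, 0 <= u k) ->
        measurable_fun [set: G] u ->
        act t u (gcomp Gd g h) = act t (left_shift Gd g u) h].

Lemma transition_cst t (c : R) g : (0 <= c)%R -> transition t ->
  act t (cst c%:E) g = c%:E.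
Proof.
move=> c0 [t0 mt t1 _]; rewrite -[RHS]mule1 -(t1 g) -actZ//.
by apply: eq_integral => h _; rewrite mule1.
Qed.

Lemma transition_mass t g : transition t -> \int[lam (tgt Gd g)]_h t (g, h) = 1.
Proof.
by move=> [_ _ t1 _]; rewrite -(t1 g); apply: eq_integral => h _; rewrite mule1.
Qed.

Lemma transition_le1 t u g : transition t -> (forall h, 0 <= u h) ->
  measurable_fun [set: G] u -> (forall h, u h <= 1) -> act t u g <= 1.
Proof.
move=> tt u0 mu u1; have [t0 mt t1 _] := tt; rewrite -(t1 g).
by apply: le_act => //; exact: aeW.
Qed.

Definition convolution t1 t2 (p : G * G) : \bar R :=
  \int[lam (tgt Gd p.1)]_z (t1 (p.1, z) * t2 (z, p.2)).

Lemma measurable_convolution t1 t2 : (forall p, 0 <= t1 p) ->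
  measurable_fun [set: G * G] t1 -> (forall p, 0 <= t2 p) ->
  measurable_fun [set: G * G] t2 -> measurable_fun [set: G * G] (convolution t1 t2).
Proof.
move=> t10 mt1 t20 mt2.
apply: (measurable_kernel_integral lam_proper (f := fun p : G * G => tgt Gd p.1)
   (F := fun p : (G * G) * G => t1 (p.1.1, p.2) * t2 (p.2, p.1.2))).
- exact: measurableT_comp (measurable_tgt bG) measurable_fst.
- by move=> p; rewrite mule_ge0.
- apply: emeasurable_funM.
    apply: measurableT_comp mt1 _; apply/measurable_fun_pair.
      exact: measurableT_comp measurable_fst measurable_fst.
    exact: measurable_snd.
  apply: measurableT_comp mt2 _; apply/measurable_fun_pair; first exact: measurable_snd.
  exact: measurableT_comp measurable_snd measurable_fst.
Qed.

(** Tonelli on the fibre over [tgt g]. *)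
Lemma act_convolution t1 t2 u g : (forall p, 0 <= t1 p) ->
  measurable_fun [set: G * G] t1 -> (forall p, 0 <= t2 p) ->
  measurable_fun [set: G * G] t2 -> (forall h, 0 <= u h) -> measurable_fun [set: G] u ->
  act (convolution t1 t2) u g = act t1 (act t2 u) g.
Proof.
move=> t10 mt1 t20 mt2 u0 mu; pose x := tgt Gd g.
pose F (p : G * G) := t1 (g, p.2) * t2 (p.2, p.1) * u p.1.
have F0 p : 0 <= F p by rewrite !mule_ge0.
have mF : measurable_fun [set: G * G] F.
  apply: emeasurable_funM; last exact: measurableT_comp mu measurable_fst.
  apply: emeasurable_funM.
    exact: measurableT_comp (measurable_section g mt1) measurable_snd.
  by apply: measurableT_comp mt2 _; apply/measurable_fun_pair;
    [exact: measurable_snd|exact: measurable_fst].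
transitivity (\int[lam x]_k \int[lam x]_z F (k, z)).
  apply: eq_integral => k _; rewrite /convolution/= -ge0_integralZr//.
  - by apply: emeasurable_funM; [exact: measurable_section|exact: measurable_cosection].
  - by move=> z _; rewrite mule_ge0.
rewrite sigma_finite_tonelli//; last exact: system_sigma_finite.
have -> : \int[lam x]_z \int[lam x]_k F (k, z) =
    \int[lam x]_z (t1 (g, z) * \int[lam x]_k (t2 (z, k) * u k)).
  apply: eq_integral => z _; rewrite -ge0_integralZl//.
  - by apply: eq_integral => k _; rewrite /F/= muleA.
  - exact: measurable_sectionM.
  - by move=> k _; rewrite mule_ge0.
apply: (integral_fibre bG).
- apply: measurable_sectionM => //.
  apply: (measurable_kernel_integral lam_proper (f := cst x)
    (F := fun p : G * G => t2 p * u p.2)).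
  + exact: measurable_cst.
  + by move=> p; rewrite mule_ge0.
  + by apply: emeasurable_funM => //; exact: measurableT_comp mu measurable_snd.
- by apply: measurable_sectionM => //; exact: measurable_act.
- by move=> z zx; rewrite /act zx.
Qed.

Lemma transition_convolution t1 t2 : transition t1 -> transition t2 ->
  transition (convolution t1 t2).
Proof.
move=> [t10 mt1 t11 ti1] [t20 mt2 t21 ti2]; split.
- by move=> p; apply: integral_ge0 => z _; rewrite mule_ge0.
- exact: measurable_convolution.
- move=> g; rewrite act_convolution//.
  by rewrite -[RHS](t11 g); congr act; apply/funext => h; rewrite t21.
- move=> g h u gh u0 mu; have mtu := measurable_act t20 mt2 u0 mu.
  have lu0 := left_shift_ge0 Gd g u0; have mlu := measurable_left_shift bG g mu.
  rewrite !act_convolution// ti1//; last by move=> k; exact: act_ge0.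
  apply: act_fibre => //.
  + exact: measurable_left_shift.
  + exact: measurable_act.
  + by move=> k kh; rewrite left_shiftE ?ti2// kh.
Qed.

(** The weights [(1 - s) s^j] serve twice: with [s] close to 1 for the Abel means
    of the powers of one kernel, and with [s = 1/2] for a convex combination of
    a sequence of kernels. *)
Definition geometric_mean (s : R) (t_ : (G * G -> \bar R)^nat) (p : G * G) : \bar R :=
  \sum_(j <oo) (((1 - s) * s ^+ j)%:E * t_ j p).

Let geo_ge0 (s : R) j : (0 <= s < 1)%R -> (0 <= (1 - s) * s ^+ j)%R.
Proof. by move=> /andP[s0 s1]; rewrite mulr_ge0 ?exprn_ge0// subr_ge0 ltW. Qed.

Lemma act_geometric_mean s (t_ : (G * G -> \bar R)^nat) u g : (0 <= s < 1)%R ->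
  (forall j p, 0 <= t_ j p) -> (forall j, measurable_fun [set: G * G] (t_ j)) ->
  (forall h, 0 <= u h) -> measurable_fun [set: G] u ->
  act (geometric_mean s t_) u g =
  \sum_(j <oo) (((1 - s) * s ^+ j)%:E * act (t_ j) u g).
Proof.
move=> s01 t0 mt u0 mu.
have c0 j := geo_ge0 j s01.
have m1 j : measurable_fun [set: G] (fun h => t_ j (g, h) * u h).
  exact: measurable_sectionM.
transitivity (\int[lam (tgt Gd g)]_h
    \sum_(j <oo) (((1 - s) * s ^+ j)%:E * (t_ j (g, h) * u h))).
  apply: eq_integral => h _; rewrite /geometric_mean muleC.
  rewrite -nneseriesZl_ge0//; last by move=> j; rewrite mule_ge0// lee_fin.
  by apply: eq_eseriesr => j _; rewrite muleC muleA.
rewrite integral_nneseries//; last 2 first.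
- by move=> j; exact: measurable_funeM.
- by move=> j h _; rewrite !mule_ge0// lee_fin.
apply: eq_eseriesr => j _; rewrite ge0_integralZl// ?lee_fin//.
by move=> h _; rewrite mule_ge0.
Qed.

Lemma transition_geometric_mean s (t_ : (G * G -> \bar R)^nat) : (0 <= s < 1)%R ->
  (forall j, transition (t_ j)) -> transition (geometric_mean s t_).
Proof.
move=> s01 tt.
have c0 j := geo_ge0 j s01.
have t0 j p : 0 <= t_ j p by case: (tt j).
have mt j : measurable_fun [set: G * G] (t_ j) by case: (tt j).
split.
- by move=> p; apply: nneseries_ge0 => j _ _; rewrite mule_ge0// lee_fin.
- apply: ge0_emeasurable_sum => [j p _ _|j _]; first by rewrite mule_ge0// lee_fin.
  exact: measurable_funeM.
- move=> g; rewrite act_geometric_mean// -[RHS](eseries_geometric s01).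
  by apply: eq_eseriesr => j _; case: (tt j) => _ _ -> _; rewrite mule1.
- move=> g h u gh u0 mu.
  have lu0 := left_shift_ge0 Gd g u0; have mlu := measurable_left_shift bG g mu.
  rewrite !act_geometric_mean//.
  by apply: eq_eseriesr => j _; case: (tt j) => _ _ _ ->.
Qed.

Definition represents (theta : borel_system R Gd) t : Prop :=
  forall g u, (forall h, 0 <= u h) -> measurable_fun [set: G] u ->
    act t u g = \int[theta (src Gd g)]_h left_shift Gd g u h.

Lemma translateE (theta : borel_system R Gd) g E : measurable E ->
  translate Gd g (theta (src Gd g)) E =
  \int[theta (src Gd g)]_h left_shift Gd g (fun h => (\1_E h)%:E) h.
Proof.
move=> mE; have mfE : measurable (fibre Gd (src Gd g) `&` gcomp Gd g @^-1` E).
  by apply: (measurable_left_mul bG) => //; exact: (measurable_fibre bG).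
rewrite /translate -[LHS]mul1e -integral_cst// integral_mkcond.
apply: eq_integral => h _; rewrite /left_shift !patchE in_setI indicE.
have -> : (h \in gcomp Gd g @^-1` E) = (gcomp Gd g h \in E).
  by apply/idP/idP => /set_mem ?; exact/mem_set.
by case: (h \in fibre _ _); case: (_ \in E).
Qed.

Lemma left_shift_additive g u v h :
  left_shift Gd g (fun k => u k + v k) h = left_shift Gd g u h + left_shift Gd g v h.
Proof. by rewrite /left_shift !patchE; case: ifP => // _; rewrite adde0. Qed.

Lemma left_shift_scale g (c : R) u h :
  left_shift Gd g (fun k => c%:E * u k) h = c%:E * left_shift Gd g u h.
Proof. by rewrite /left_shift !patchE; case: ifP => // _; rewrite mule0. Qed.

Lemma represents_translate (theta : borel_system R Gd) t :
  (forall p, 0 <= t p) -> measurable_fun [set: G * G] t ->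
  (forall g E, measurable E -> translate Gd g (theta (src Gd g)) E =
     \int[lam (tgt Gd g)]_(h in E) t (g, h)) -> represents theta t.
Proof.
move=> t0 mt h g; apply: ge0_measurable_ind.
- by move=> E mE; rewrite -translateE// h// act_indic.
- move=> u v u0 v0 mu mv hu hv; rewrite actD// hu hv -ge0_integralD//.
  + by apply: eq_integral => k _; rewrite left_shift_additive.
  + by move=> k _; exact: left_shift_ge0.
  + exact: (measurable_left_shift bG).
  + by move=> k _; exact: left_shift_ge0.
  + exact: (measurable_left_shift bG).
- move=> c u c0 u0 mu hu; rewrite actZ// hu -ge0_integralZl//.
  + by apply: eq_integral => k _; rewrite left_shift_scale.
  + exact: (measurable_left_shift bG).
  + by move=> k _; exact: left_shift_ge0.
- move=> u u0 mu ndu hu.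
  have E1 : act t (fun k => limn (u ^~ k)) g = limn (fun n => act t (u n) g).
    rewrite /act -monotone_convergence//.
    + by apply: eq_integral => k _; rewrite limeMl_ge0.
    + by move=> n; exact: measurable_sectionM.
    + by move=> n k _; rewrite mule_ge0.
    + by move=> k _ i j ij; rewrite lee_wpmul2l// ndu.
  rewrite E1 (_ : (fun n => act t (u n) g) =
    (fun n => \int[theta (src Gd g)]_k left_shift Gd g (u n) k)); last exact/funext.
  rewrite -monotone_convergence//.
  + apply: eq_integral => k _; rewrite /left_shift patchE; case: ifPn => kf.
      by under eq_fun do rewrite patchE kf.
    by under eq_fun do rewrite patchE (negbTE kf); rewrite lim_cst.
  + by move=> n; exact: (measurable_left_shift bG).
  + by move=> n k _; exact: left_shift_ge0.
  + by move=> k _ i j ij; rewrite /left_shift !patchE; case: ifP => // _; exact: ndu.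
Qed.

(** Invariance comes from associativity: translating by [h] and then by [g] is
    translating by [g h]. *)
Lemma adapted_transition (theta : borel_system R Gd) : adapted_probability lam theta ->
  exists2 t, transition t & represents theta t.
Proof.
move=> [theta1 _ [t [t0 mt tD]]]; exists t; last exact: represents_translate.
have rep := represents_translate t0 mt tD.
have mf x := measurable_fibre bG x.
split => //.
- move=> g; rewrite rep//.
  rewrite /left_shift -integral_mkcond integral_cst// mul1e.
  rewrite -(theta1 (src Gd g)) -(setUv (fibre Gd (src Gd g))) measureU//.
  + by rewrite [X in (_ + X)%E](_ : _ = 0) ?adde0//; exact: system_fibre.
  + exact: measurableC.
  + by rewrite setICr.
- move=> g h u gh u0 mu; rewrite !rep//; last 2 first.
  + exact: left_shift_ge0.
  + exact: (measurable_left_shift bG).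
  rewrite src_comp//; apply: eq_integral => k _.
  rewrite /left_shift !patchE src_comp//; case: ifPn => // /set_mem/= kf.
  rewrite mem_set; last by rewrite /fibre/= tgt_comp.
  by rewrite Defs.compA.
Qed.

Section system_of_transition.
Variable t : G * G -> \bar R.
Hypothesis tt : transition t.

Let t0 p : 0 <= t p. Proof. by case: tt. Qed.
Let mt : measurable_fun [set: G * G] t. Proof. by case: tt. Qed.

Let theta (x : X) : {measure set G -> \bar R} :=
  density_measure (lam x) (fun h => t0 (unit_arrow Gd x, h))
    (measurable_section (unit_arrow Gd x) mt).

Let theta_mass x : theta x [set: G] = 1.
Proof.
have := transition_mass (unit_arrow Gd x) tt; rewrite tgt_unit; exact.
Qed.

Let theta_sigma_finite x : sigma_finite [set: G] (theta x).
Proof.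
apply: fin_num_fun_sigma_finite; first by rewrite measure0.
by apply: lty_fin_num_fun; rewrite theta_mass ltry.
Qed.

Let theta_null x E : measurable E -> lam x E = 0 -> theta x E = 0.
Proof.
move=> mE lE; rewrite /theta/= /density_measure; apply: null_set_integral => //.
by apply: measurable_funTS; exact: measurable_section.
Qed.

Let theta_fibre x : theta x (~` fibre Gd x) = 0.
Proof.
apply: theta_null; last exact: system_fibre.
by apply: measurableC; exact: (measurable_fibre bG).
Qed.

Let theta_integral x u : (forall h, 0 <= u h) -> measurable_fun [set: G] u ->
  \int[theta x]_h u h = act t u (unit_arrow Gd x).
Proof. by move=> u0 mu; rewrite integral_density_measure// /act tgt_unit. Qed.

Let theta_borel u : (forall g, 0 <= u g) -> measurable_fun [set: G] u ->
  measurable_fun [set: X] (fun x => \int[theta x]_g u g).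
Proof.
move=> u0 mu; under eq_fun do rewrite theta_integral//.
apply: measurableT_comp; first exact: measurable_act.
exact: (measurable_unit_arrow bG).
Qed.

(** The measure at [x] has density [t (unit x, -)]; invariance of [t] identifies
    its translate by [g], since [g (unit x) = g] for [x = src g]. *)
Lemma transition_adapted : exists2 theta : borel_system R Gd,
  adapted_probability lam theta & represents theta t.
Proof.
pose th := BorelSystem theta_sigma_finite theta_fibre theta_borel.
have rep : represents th t.
  move=> g u u0 mu; rewrite theta_integral//; last 2 first.
  - exact: left_shift_ge0.
  - exact: (measurable_left_shift bG).
  have [_ _ _ <- //] := tt; last by rewrite tgt_unit.
  by rewrite comp_unitr.
exists th => //; split => //.
- by move=> x; apply/null_content_dominatesP => E mE; exact: theta_null.
- exists t; split => // g E mE; rewrite translateE// -rep -?act_indic//.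
  by apply/measurable_EFinP; exact: measurable_indic.
Qed.

End system_of_transition.

(** [fine] makes the difference meaningful; it changes [t] only on null sets, as
    densities of finite measures are finite almost everywhere. *)
Definition invariance_defect t (g : G) : \bar R :=
  \int[lam (tgt Gd g)]_h
    (`|fine (t (unit_arrow Gd (tgt Gd g), h)) - fine (t (g, h))|)%:E.

Lemma measurable_invariance_defect t : measurable_fun [set: G * G] t ->
  measurable_fun [set: G] (invariance_defect t).
Proof.
move=> mt; apply: (measurable_kernel_integral lam_proper (f := tgt Gd)
  (F := fun p : G * G =>
    (`|fine (t (unit_arrow Gd (tgt Gd p.1), p.2)) - fine (t (p.1, p.2))|)%:E)).
- exact: (measurable_tgt bG).
- by move=> p; rewrite lee_fin.
apply/measurable_EFinP; apply: measurableT_comp => //; apply: measurable_funB.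
  apply: measurableT_comp => //; apply: measurableT_comp mt _.
  apply/measurable_fun_pair; last exact: measurable_snd.
  apply: measurableT_comp; first exact: (measurable_unit_arrow bG).
  exact: measurableT_comp (measurable_tgt bG) measurable_fst.
apply: measurableT_comp => //; apply: measurableT_comp mt _.
by apply/measurable_fun_pair; [exact: measurable_fst|exact: measurable_snd].
Qed.

Lemma invariance_defect_ge0 t g : 0 <= invariance_defect t g.
Proof. by apply: integral_ge0 => h _; rewrite lee_fin. Qed.

Lemma represents_unit (theta : borel_system R Gd) t x E : represents theta t ->
  measurable E -> theta x E = \int[lam x]_(h in E) t (unit_arrow Gd x, h).
Proof.
move=> rep mE; have := act_indic t (unit_arrow Gd x) mE; rewrite tgt_unit => <-.
have mi : measurable_fun [set: G] (fun h => (\1_E h)%:E : \bar R).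
  by apply/measurable_EFinP; exact: measurable_indic.
rewrite rep// src_unit -[LHS]mul1e -integral_cst// integral_mkcond.
transitivity (\int[theta x]_h (\1_E h)%:E).
  by apply: eq_integral => h _; rewrite patchE indicE; case: (h \in E).
apply: (integral_fibre bG) => //; first exact: (measurable_left_shift bG).
by move=> h <-; rewrite left_shiftE ?src_unit// comp_unitl.
Qed.

Lemma reiter_defectE (theta : borel_system R Gd) t : transition t ->
  represents theta t -> reiter_defect theta = invariance_defect t.
Proof.
move=> tt rep; have [t0 mt _ _] := tt; apply/funext => g.
apply: total_variation_norm_density => //.
- exact: measurable_section.
- exact: measurable_section.
- by have := transition_mass (unit_arrow Gd (tgt Gd g)) tt; rewrite tgt_unit.
- exact: transition_mass.
- move=> E mE; rewrite (represents_unit _ rep)// translateE// -rep ?act_indic//.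
  by apply/measurable_EFinP; exact: measurable_indic.
Qed.

End densities.

(** * Abel means of the powers of a kernel *)

Section random_walk.
Local Open Scope ereal_scope.
Context (R : realType) (dX dG : measure_display)
  (X : measurableType dX) (G : measurableType dG) (Gd : groupoid X G).
Hypothesis bG : borel_groupoid R Gd.
Variable lam : borel_system R Gd.
Hypothesis lam_proper : proper_system lam.
Variable t : G * G -> \bar R.
Hypothesis tt : transition lam t.

Let t0 p : 0 <= t p. Proof. by case: tt. Qed.
Let mt : measurable_fun [set: G * G] t. Proof. by case: tt. Qed.

Fixpoint convolution_power (j : nat) : G * G -> \bar R :=
  if j is j'.+1 then convolution lam t (convolution_power j') else t.

Lemma transition_convolution_power j : transition lam (convolution_power j).
Proof. by elim: j => //= j ih; exact: transition_convolution. Qed.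

Let pw_ge0 j p : 0 <= convolution_power j p.
Proof. by case: (transition_convolution_power j). Qed.

Let mpw j : measurable_fun [set: G * G] (convolution_power j).
Proof. by case: (transition_convolution_power j). Qed.

Definition abel_mean (n : nat) : G * G -> \bar R :=
  geometric_mean (1 - n.+1%:R^-1)%R convolution_power.

Let s01 n : (0 <= 1 - (n.+1%:R : R)^-1 < 1)%R.
Proof. by rewrite subr_ge0 invf_le1// ler1n/= gtrBl invr_gt0. Qed.

Lemma transition_abel_mean n : transition lam (abel_mean n).
Proof. by apply: transition_geometric_mean => // j; exact: transition_convolution_power. Qed.

Section almost_harmonic.
Variables (n : nat) (u : G -> \bar R).
Hypotheses (u0 : forall h, 0 <= u h) (mu : measurable_fun [set: G] u)
  (u1 : forall h, u h <= 1).

Let s : R := (1 - n.+1%:R^-1)%R.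
Let H := act lam (abel_mean n) u.

Let H1 g : H g <= 1. Proof. by apply: transition_le1 => //; exact: transition_abel_mean. Qed.

Let Am0 p : 0 <= abel_mean n p. Proof. by case: (transition_abel_mean n). Qed.
Let mAm : measurable_fun [set: G * G] (abel_mean n).
Proof. by case: (transition_abel_mean n). Qed.

Let H0 g : 0 <= H g. Proof. exact: act_ge0. Qed.
Let mH : measurable_fun [set: G] H. Proof. exact: measurable_act. Qed.

Let a j g := act lam (convolution_power j) u g.

Let a0 j g : 0 <= a j g. Proof. exact: act_ge0. Qed.

Let a1 j g : a j g <= 1.
Proof. by apply: transition_le1 => //; exact: transition_convolution_power. Qed.

Let ma j : measurable_fun [set: G] (a j). Proof. exact: measurable_act. Qed.

Let c0 j : (0 <= (1 - s) * s ^+ j)%R.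
Proof.
by have /andP[s0 s1] := s01 n; rewrite mulr_ge0 ?exprn_ge0// subr_ge0 ltW.
Qed.

Let HE g : H g = \sum_(j <oo) (((1 - s) * s ^+ j)%:E * a j g).
Proof. exact: act_geometric_mean. Qed.

Let actHE g : act lam t H g = \sum_(j <oo) (((1 - s) * s ^+ j)%:E * a j.+1 g).
Proof.
rewrite /act; transitivity (\int[lam (tgt Gd g)]_h
    (\sum_(j <oo) (t (g, h) * (((1 - s) * s ^+ j)%:E * a j h)))).
  apply: eq_integral => h _; rewrite HE nneseriesZl_ge0// => j.
  by rewrite mule_ge0// lee_fin.
rewrite integral_nneseries//; last 2 first.
- by move=> j; apply: measurable_sectionM => //; exact: measurable_funeM.
- by move=> j h _; rewrite !mule_ge0// lee_fin.
apply: eq_eseriesr => j _.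
rewrite -/(act lam t (fun h => ((1 - s) * s ^+ j)%:E * a j h) g) actZ//; congr (_ * _).
by rewrite /a /= act_convolution.
Qed.

(** Abel means are almost invariant because [H = (1 - s) a_0 + s P H]. *)
Let HrecE g : H g = (1 - s)%:E * a 0%N g + s%:E * act lam t H g.
Proof.
have /andP[s0 s1] := s01 n.
rewrite HE nneseries_recl//; last by move=> j _; rewrite mule_ge0// lee_fin.
rewrite expr0 mulr1; congr (_ + _).
rewrite actHE -nneseriesZl; last by move=> j _; rewrite mule_ge0// lee_fin.
rewrite -(nneseries_addn 1%N); last by move=> j; rewrite mule_ge0// lee_fin.
by apply: eq_eseriesr => j _; rewrite addn1 muleA -EFinM; congr (_%:E * _); rewrite exprS; ring.
Qed.

Let tH0 g : 0 <= act lam t H g. Proof. exact: act_ge0. Qed.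
Let tH1 g : act lam t H g <= 1. Proof. exact: transition_le1. Qed.

Let fin01 (y : \bar R) : 0 <= y -> y <= 1 -> y \is a fin_num.
Proof. by move=> y0 y1; rewrite ge0_fin_numE// (le_lt_trans y1)// ltry. Qed.

Lemma abel_mean_le_act g : H g <= act lam t H g + (n.+1%:R^-1)%:E.
Proof.
have /andP[s0 s1] := s01 n; have := HrecE g.
have := a0 0%N g; have := a1 0%N g; have := tH0 g; have := tH1 g.
rewrite -[H g]fineK ?fin01// -[act lam t H g]fineK ?fin01// -[a 0%N g]fineK ?fin01//.
rewrite -!EFinM -!EFinD !lee_fin => h1 h2 h3 h4 [h5].
move: s0 s1 h5; rewrite /s; move: (n.+1%:R^-1)%R => e s0 s1 ->.
have : (0 <= e * (1 - fine (a 0%N g) + fine (act lam t H g)))%R by apply: mulr_ge0; lra.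
by lra.
Qed.

Lemma act_le_abel_mean g : act lam t H g <= H g + (n.+1%:R^-1)%:E.
Proof.
have /andP[s0 s1] := s01 n; have := HrecE g.
have := a0 0%N g; have := a1 0%N g; have := tH0 g; have := tH1 g.
rewrite -[H g]fineK ?fin01// -[act lam t H g]fineK ?fin01// -[a 0%N g]fineK ?fin01//.
rewrite -!EFinM -!EFinD !lee_fin => h1 h2 h3 h4 [h5].
move: s0 s1 h5; rewrite /s; move: (n.+1%:R^-1)%R => e s0 s1 ->.
have : (0 <= e * (1 + fine (a 0%N g) - fine (act lam t H g)))%R by apply: mulr_ge0; lra.
by lra.
Qed.

End almost_harmonic.

(** The convergence is assumed almost everywhere but concluded at every [z] of
    the fibre: the transition probability from [z] has a density. *)
Lemma act_cvg x (u : nat -> G -> R) (v : G -> R) z :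
  (forall n, measurable_fun [set: G] (u n)) -> (forall n h, (0 <= u n h <= 1)%R) ->
  measurable_fun [set: G] v ->
  {ae lam x, forall h, u n h @[n --> \oo] --> v h} -> tgt Gd z = x ->
  act lam t (EFin \o u n) z @[n --> \oo] --> act lam t (EFin \o v) z.
Proof.
move=> mu u01 mv uv zx; rewrite /act zx.
have tz1 : \int[lam x]_h t (z, h) = 1 by rewrite -zx; exact: transition_mass.
have mtz := measurable_section z mt.
have tzfin : {ae lam x, forall h, t (z, h) < +oo}.
  by apply: ae_lty_integral => //; rewrite tz1 ltry.
have [//|//||||] := @dominated_convergence _ _ R (lam x) [set: G] measurableT
  (fun n h => t (z, h) * (u n h)%:E) (fun h => t (z, h) * (v h)%:E) (fun h => t (z, h)).
- by move=> n; apply: emeasurable_funM => //; exact/measurable_EFinP.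
- by apply: emeasurable_funM => //; exact/measurable_EFinP.
- apply: filterS2 uv tzfin => h uvh th _.
  apply: cvgeZl; first by rewrite ge0_fin_numE.
  exact: cvg_EFin (nearW _ _) _.
- apply/integrableP; split => //.
  by under eq_integral do rewrite gee0_abs//; rewrite tz1 ltry.
- apply: aeW => h n _; have /andP[un0 un1] := u01 n h.
  rewrite gee0_abs; last by rewrite mule_ge0// lee_fin.
  by rewrite -[leRHS]mule1 lee_wpmul2l// lee_fin.
- by [].
Qed.

End random_walk.

(** * Asymptotic invariance of the Abel means *)

Section abel_mean_invariance.
Local Open Scope ereal_scope.
Context (R : realType) (dX dG : measure_display)
  (X : measurableType dX) (G : measurableType dG) (Gd : groupoid X G).
Hypothesis bG : borel_groupoid R Gd.
Variable lam : borel_system R Gd.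
Hypothesis lam_proper : proper_system lam.
Variable t : G * G -> \bar R.
Hypothesis tt : transition lam t.

Let t0 p : 0 <= t p. Proof. by case: tt. Qed.
Let mt : measurable_fun [set: G * G] t. Proof. by case: tt. Qed.

Variables (x : X) (F : G -> \bar R).
Hypotheses (F0 : forall h, 0 < F h) (mF : measurable_fun [set: G] F)
  (Foo : \int[lam x]_h F h < +oo).
Hypothesis harmonic_cst : forall v : G -> R, measurable_fun [set: G] v ->
  (forall h, (0 <= v h <= 1)%R) ->
  {ae lam x, forall z, act lam t (EFin \o v) z = (v z)%:E} ->
  exists c : R, {ae lam x, forall z, v z = c}.

Let mE (u : G -> R) : measurable_fun [set: G] u ->
  measurable_fun [set: G] (EFin \o u).
Proof. by move=> mu; exact/measurable_EFinP. Qed.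

Let E0 (u : G -> R) : (forall h, (0 <= u h <= 1)%R) -> forall h, 0 <= (EFin \o u) h.
Proof. by move=> u01 h; rewrite lee_fin; case/andP: (u01 h). Qed.

Let E1 (u : G -> R) : (forall h, (0 <= u h <= 1)%R) -> forall h, (EFin \o u) h <= 1.
Proof. by move=> u01 h; rewrite lee_fin; case/andP: (u01 h). Qed.

Let act_fin (u : G -> R) z : measurable_fun [set: G] u ->
  (forall h, (0 <= u h <= 1)%R) -> act lam t (EFin \o u) z \is a fin_num.
Proof.
move=> mu u01; rewrite ge0_fin_numE; last by apply: act_ge0 => //; exact: E0.
apply: (@le_lt_trans _ _ 1); last exact: ltry.
by apply: transition_le1 => //; [exact: E0|exact: mE|exact: E1].
Qed.

Let almost_harmonic n (u : G -> R) := forall z,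
  act lam t (EFin \o u) z <= (u z + n.+1%:R^-1)%:E /\
  (u z)%:E <= act lam t (EFin \o u) z + (n.+1%:R^-1)%:E.

Let almost_harmonic_cvg (u : nat -> G -> R) (v : G -> R) z :
  (forall n, measurable_fun [set: G] (u n)) -> (forall n h, (0 <= u n h <= 1)%R) ->
  (forall n, almost_harmonic n (u n)) ->
  measurable_fun [set: G] v -> (forall h, (0 <= v h <= 1)%R) ->
  {ae lam x, forall h, u n h @[n --> \oo] --> v h} -> tgt Gd z = x ->
  u n z @[n --> \oo] --> fine (act lam t (EFin \o v) z).
Proof.
move=> mu u01 hu mv v01 uv zx.
have h1 : fine (act lam t (EFin \o u n) z) @[n --> \oo] --> fine (act lam t (EFin \o v) z).
  apply: fine_cvg; rewrite fineK; last exact: act_fin.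
  exact: act_cvg uv zx.
have h2 : (u n z - fine (act lam t (EFin \o u n) z))%R @[n --> \oo] --> (0 : R)%R.
  apply/cvgr0Pnorm_le => e e0.
  have /cvgr0_norm_le/(_ _ e0) := @cvg_harmonic R.
  apply: filterS => n; rewrite /harmonic/= ger0_norm ?invr_ge0// => ne.
  apply: le_trans ne.
  have [p pE] : exists p : R, act lam t (EFin \o u n) z = p%:E.
    by exists (fine (act lam t (EFin \o u n) z)); rewrite fineK// act_fin.
  have [] := hu n z; rewrite pE -EFinD !lee_fin/=.
  move: (n.+1%:R^-1)%R => q a b; rewrite ler_norml; apply/andP; split; lra.
rewrite -[X in _ --> X]add0r.
have -> : (fun n => u n z) = (fun n => (u n z - fine (act lam t (EFin \o u n) z)) +
    fine (act lam t (EFin \o u n) z))%R by apply/funext => n; rewrite subrK.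
exact: cvgD h2 h1.
Qed.

(** The functions in question form decreasing convex sets; the limit of a
    sequence chosen in them is harmonic, so constant, and the gap between the
    values at [g] and at the unit disappears in the limit. *)
Let no_almost_harmonic_gap g e : tgt Gd g = x -> (0 < e)%R ->
  ~ forall N, exists u : G -> R, [/\ measurable_fun [set: G] u,
      forall h, (0 <= u h <= 1)%R, almost_harmonic N u &
      (u g + e <= u (unit_arrow Gd x))%R].
Proof.
move=> gx e0 ne.
pose C N : set (G -> R) := [set u : G -> R | [/\ measurable_fun [set: G] u,
      forall h, (0 <= u h <= 1)%R, almost_harmonic N u &
      (u g + e <= u (unit_arrow Gd x))%R]].
have C_mid n (u v : G -> R) : C n u -> C n v -> C n (fun h => (u h + v h) / 2)%R.
  move=> [mu u01 hu eu] [mv v01 hv ev]; split.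
  - by apply: measurable_funM => //; exact: measurable_funD.
  - by move=> h; have := u01 h; have := v01 h; lra.
  - move=> z.
    have -> : EFin \o (fun h => (u h + v h) / 2)%R =
        fun h => (2^-1)%:E * ((EFin \o u) h + (EFin \o v) h).
      by apply/funext => h /=; rewrite -EFinD -EFinM mulrC.
    have u0 := E0 u01; have v0 := E0 v01; have mu' := mE mu; have mv' := mE mv.
    rewrite actZ ?invr_ge0//; last 2 first.
    + by move=> h; rewrite adde_ge0.
    + exact: emeasurable_funD.
    rewrite actD//.
    have [p pE] : exists p : R, act lam t (EFin \o u) z = p%:E.
      by exists (fine (act lam t (EFin \o u) z)); rewrite fineK// act_fin.
    have [q qE] : exists q : R, act lam t (EFin \o v) z = q%:E.
      by exists (fine (act lam t (EFin \o v) z)); rewrite fineK// act_fin.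
    have [] := hu z; have [] := hv z; rewrite pE qE -!EFinD !lee_fin.
    by move: (n.+1%:R^-1)%R => r h1 h2 h3 h4; split; rewrite ?lee_fin; lra.
  - by lra.
have C_decr k n : (k <= n)%N -> C n `<=` C k.
  move=> kn u [mu u01 hu eu]; split => // z; have [h1 h2] := hu z.
  have kn' : (n.+1%:R^-1 <= k.+1%:R^-1 :> R)%R by rewrite lef_pV2 ?posrE// ler_nat.
  split; [apply: le_trans h1 _|apply: le_trans h2 _].
    by rewrite lee_fin lerD2l.
  by rewrite leeD2l// lee_fin.
have C_unit n u : C n u -> measurable_fun [set: G] u /\ forall h, (0 <= u h <= 1)%R.
  by case.
have [u [Cu ucvg]] := midpoint_convex_ae_cvg F0 mF Foo C_unit C_mid C_decr ne.
have mu n : measurable_fun [set: G] (u n) by case: (Cu n).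
have u01 n : forall h, (0 <= u n h <= 1)%R by case: (Cu n).
(* The limit where it exists, made Borel and bounded everywhere. *)
pose vE h := limn_esup (fun n => (u n h)%:E).
pose v h := Num.min 1%R (Num.max 0%R (fine (vE h))).
have mv : measurable_fun [set: G] v.
  apply: measurable_minr => //; apply: measurable_maxr => //.
  by apply: measurableT_comp => //; apply: measurable_fun_limn_esup => n; exact: mE.
have v01 h : (0 <= v h <= 1)%R.
  by rewrite /v ge_min lexx/= andbT le_min ler01/= le_max lexx.
have uv : {ae lam x, forall h, u n h @[n --> \oo] --> v h}.
  apply: filterS ucvg => h uh.
  suff -> : v h = limn (u ^~ h) by [].
  rewrite /v; have -> : vE h = (limn (u ^~ h))%:E.
    rewrite /vE is_cvg_limn_esupE; first by rewrite EFin_lim.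
    by apply/cvg_ex; exists (limn (u ^~ h))%:E; apply: cvg_EFin => //; exact: nearW.
  have l0 : (0 <= limn (u ^~ h))%R.
    by apply: limr_ge => //; apply: nearW => n; case/andP: (u01 n h).
  have l1 : (limn (u ^~ h) <= 1)%R.
    by apply: limr_le => //; apply: nearW => n; case/andP: (u01 n h).
  by rewrite /= (max_idPr l0) (min_idPr l1).
have uK z : tgt Gd z = x -> u n z @[n --> \oo] --> fine (act lam t (EFin \o v) z).
  by apply: almost_harmonic_cvg => // n; case: (Cu n).
have fibre_ae : {ae lam x, forall z, tgt Gd z = x}.
  exists (~` fibre Gd x); split => //.
    by apply: measurableC; exact: (measurable_fibre bG).
  exact: system_fibre.
have [c0 vc0] : exists c : R, {ae lam x, forall z, v z = c}.
  apply: harmonic_cst => //; apply: filterS2 uv fibre_ae => z uz zx.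
  rewrite -[LHS]fineK ?act_fin//; congr EFin.
  by apply: cvg_unique uz => //; exact: uK.
(* [c0] may be negative if the fibre is a null set. *)
pose c := Num.max c0 0%R.
have vc : {ae lam x, forall z, (v z)%:E = c%:E}.
  apply: filterS vc0 => z vz; rewrite /c -vz; congr EFin; apply/esym/max_idPl.
  by case/andP: (v01 z).
have c_ge0 : (0 <= c)%R by rewrite le_max lexx orbT.
have Kc z : tgt Gd z = x -> fine (act lam t (EFin \o v) z) = c.
  move=> zx; rewrite -[RHS](_ : fine c%:E = c)//; congr fine.
  rewrite -(transition_cst z c_ge0 tt); apply/eqP; rewrite eq_le.
  have v0 := E0 v01; have mv' := mE mv; have c0' h : 0 <= cst c%:E h :> \bar R by rewrite lee_fin.
  by apply/andP; split; apply: le_act => //; rewrite zx; apply: filterS vc => h /= ->.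
have ux : tgt Gd (unit_arrow Gd x) = x by rewrite tgt_unit.
have d : (u n (unit_arrow Gd x) - u n g)%R @[n --> \oo] --> (0 : R)%R.
  by rewrite -(subrr c) -{1}(Kc _ ux) -(Kc _ gx); exact: cvgB (uK _ ux) (uK _ gx).
have /cvgr0Pnorm_lt/(_ _ e0) := d.
move=> [N _ /(_ N (leqnn N))]/=; apply/negP; rewrite -leNgt.
have [_ _ _ eN] := Cu N; apply: le_trans (ler_norm _); lra.
Qed.

(** A large defect at [g] is seen by some set [B], and the Abel mean applied to
    the indicator of [B] is then an almost harmonic function with a gap between
    [g] and the unit. *)
Lemma abel_mean_defect_cvg g : tgt Gd g = x ->
  fine (invariance_defect lam (abel_mean lam t n) g) @[n --> \oo] --> (0 : R)%R.
Proof.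
move=> gx.
have D0 n : 0 <= invariance_defect lam (abel_mean lam t n) g by exact: invariance_defect_ge0.
apply/cvgr0Pnorm_le => e e0; apply: contrapT => ne.
have e20 : (0 < e / 2)%R by rewrite divr_gt0.
apply: (no_almost_harmonic_gap gx e20) => N.
have [n Nn en] : exists2 n, (N <= n)%N &
    (e < fine (invariance_defect lam (abel_mean lam t n) g))%R.
  apply: contrapT => h; apply: ne; exists N => // n /= Nn.
  rewrite ger0_norm ?fine_ge0// leNgt; apply/negP => en; apply: h; by exists n.
have tA := transition_abel_mean bG lam_proper tt n; have [A0 mA _ _] := tA.
have ux : tgt Gd (unit_arrow Gd (tgt Gd g)) = tgt Gd g by rewrite tgt_unit.
have [||||||B mB DB] := @density_distance_upper_set _ G R (lam (tgt Gd g))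
    (fun h => abel_mean lam t n (unit_arrow Gd (tgt Gd g), h))
    (fun h => abel_mean lam t n (g, h)) => //.
- exact: measurable_section.
- exact: measurable_section.
- by rewrite -[in lam _]ux; exact: transition_mass.
- exact: transition_mass.
pose I h : \bar R := (\1_B h)%:E.
have I0 h : 0 <= I h by rewrite lee_fin.
have I1 h : I h <= 1 by rewrite lee_fin indicE; case: (_ \in _).
have mI : measurable_fun [set: G] I by apply/measurable_EFinP; exact: measurable_indic.
pose H := act lam (abel_mean lam t n) I.
have H0 z : 0 <= H z by exact: act_ge0.
have H1 z : H z <= 1 by exact: transition_le1.
have Hfin z : H z \is a fin_num by rewrite ge0_fin_numE// (le_lt_trans (H1 z))// ltry.
have HE : EFin \o (fine \o H) = H by apply/funext => z; rewrite /= fineK.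
exists (fine \o H); split.
- by apply: measurableT_comp => //; exact: measurable_act.
- by move=> z; rewrite /= -!lee_fin fineK// H0 H1.
- move=> z; rewrite HE.
  have nN : (n.+1%:R^-1 <= N.+1%:R^-1 :> R)%R by rewrite lef_pV2 ?posrE// ler_nat.
  have h1 := act_le_abel_mean bG lam_proper tt n I0 mI I1 z.
  have h2 := abel_mean_le_act bG lam_proper tt n I0 mI I1 z.
  split.
    by apply: le_trans h1 _; rewrite EFinD fineK// leeD2l// lee_fin.
  by rewrite fineK//; apply: le_trans h2 _; rewrite leeD2l// lee_fin.
- move: en; rewrite /invariance_defect DB -(act_indic _ _ _ mB).
  have := act_indic lam (abel_mean lam t n) (unit_arrow Gd (tgt Gd g)) mB.
  rewrite ux => <-; rewrite gx -/(H _) -/(H _) /=.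
  rewrite -[H g]fineK// -[H (unit_arrow _ _)]fineK// -EFinD -EFinM /=; lra.
Qed.

End abel_mean_invariance.

(** * The adjoint kernel and its Green operator *)

Lemma nneseries_split_shift (R : realType) (f : (\bar R)^nat) k :
  (forall j, 0 <= f j)%E ->
  (\sum_(j <oo) f j = \sum_(j < k) f j + \sum_(i <oo) f (i + k)%N)%E.
Proof.
by move=> f0; rewrite (nneseries_split 0%N k)// add0n big_mkord nneseries_addn.
Qed.

Section adjoint.
Local Open Scope ereal_scope.
Context (R : realType) (dX dG : measure_display)
  (X : measurableType dX) (G : measurableType dG) (Gd : groupoid X G).
Hypothesis bG : borel_groupoid R Gd.
Variable lam : borel_system R Gd.
Hypothesis lam_proper : proper_system lam.

(** The adjoint of [act lam q] for the pairing of functions on a fibre by the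
    measure of [lam]; it acts on densities. *)
Definition adjoint (q : G * G -> \bar R) (F : G -> \bar R) (h : G) : \bar R :=
  \int[lam (tgt Gd h)]_z (q (z, h) * F z).

Section fixed_kernel.
Variable q : G * G -> \bar R.
Hypotheses (q0 : forall p, 0 <= q p) (mq : measurable_fun [set: G * G] q).

Lemma adjoint_ge0 F h : (forall z, 0 <= F z) -> 0 <= adjoint q F h.
Proof. by move=> F0; apply: integral_ge0 => z _; rewrite mule_ge0. Qed.

Lemma measurable_adjoint F : (forall z, 0 <= F z) -> measurable_fun [set: G] F ->
  measurable_fun [set: G] (adjoint q F).
Proof.
move=> F0 mF.
apply: (measurable_kernel_integral lam_proper (f := tgt Gd)
  (F := fun p : G * G => q (p.2, p.1) * F p.2)).
- exact: (measurable_tgt bG).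
- by move=> p; rewrite mule_ge0.
- apply: emeasurable_funM; last exact: measurableT_comp mF measurable_snd.
  apply: measurableT_comp mq _.
  by apply/measurable_fun_pair; [exact: measurable_snd|exact: measurable_fst].
Qed.

Lemma adjoint_duality x F u : (forall z, 0 <= F z) -> measurable_fun [set: G] F ->
  (forall z, 0 <= u z) -> measurable_fun [set: G] u ->
  \int[lam x]_h (adjoint q F h * u h) = \int[lam x]_z (F z * act lam q u z).
Proof.
move=> F0 mF u0 mu.
pose K (p : G * G) := q (p.2, p.1) * F p.2 * u p.1.
have K0 p : 0 <= K p by rewrite !mule_ge0.
have mK : measurable_fun [set: G * G] K.
  apply: emeasurable_funM; last exact: measurableT_comp mu measurable_fst.
  apply: emeasurable_funM; last exact: measurableT_comp mF measurable_snd.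
  apply: measurableT_comp mq _.
  by apply/measurable_fun_pair; [exact: measurable_snd|exact: measurable_fst].
transitivity (\int[lam x]_h \int[lam x]_z K (h, z)).
  apply: (integral_fibre bG).
  - by apply: emeasurable_funM => //; exact: measurable_adjoint.
  - apply: (measurable_kernel_integral lam_proper (f := cst x) (F := K)) => //.
  - move=> h hx; rewrite /adjoint hx -ge0_integralZr//.
    + by apply: emeasurable_funM => //; exact: measurable_cosection.
    + by move=> z _; rewrite mule_ge0.
rewrite sigma_finite_tonelli//; last exact: system_sigma_finite.
apply: (integral_fibre bG).
- apply: (measurable_kernel_integral lam_proper (f := cst x)
    (F := fun p => K (p.2, p.1))) => //.
  apply: measurableT_comp mK _.
  by apply/measurable_fun_pair; [exact: measurable_snd|exact: measurable_fst].
- by apply: emeasurable_funM => //; exact: measurable_act.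
- move=> z zx; rewrite /act zx -ge0_integralZl//.
  + by apply: eq_integral => h _; rewrite /K/= muleAC [_ * F z]muleC muleA.
  + exact: measurable_sectionM.
  + by move=> h _; rewrite mule_ge0.
Qed.

Definition green (F : G -> \bar R) (h : G) : \bar R :=
  \sum_(i <oo) iter i (adjoint q) F h.

Variable F : G -> \bar R.
Hypotheses (F0 : forall z, 0 <= F z) (mF : measurable_fun [set: G] F).

Let iter_ok i : (forall z, 0 <= iter i (adjoint q) F z) /\
  measurable_fun [set: G] (iter i (adjoint q) F).
Proof.
elim: i => //= i [h1 h2]; split; first by move=> z; exact: adjoint_ge0.
exact: measurable_adjoint.
Qed.

Let it0 i z : 0 <= iter i (adjoint q) F z. Proof. by have [] := iter_ok i. Qed.
Let mit i : measurable_fun [set: G] (iter i (adjoint q) F).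
Proof. by have [] := iter_ok i. Qed.

Lemma green_ge0 h : 0 <= green F h.
Proof. by apply: nneseries_ge0 => i _ _; exact: it0. Qed.

Lemma measurable_green : measurable_fun [set: G] (green F).
Proof. by apply: ge0_emeasurable_sum => [i z _ _|i _]; [exact: it0|exact: mit]. Qed.

(** [green F] solves [H = F + q^* H]. *)
Lemma greenE h : green F h = F h + adjoint q (green F) h.
Proof.
rewrite {1}/green (nneseries_split_shift 1%N)// big_ord1; congr (_ + _).
rewrite /adjoint /green.
transitivity (\int[lam (tgt Gd h)]_z
    (\sum_(i <oo) (q (z, h) * iter i (adjoint q) F z))).
  rewrite integral_nneseries//.
  - by apply: eq_eseriesr => i _; rewrite addn1.
  - by move=> i; apply: emeasurable_funM => //; exact: measurable_cosection.
  - by move=> i z _; rewrite mule_ge0.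
by apply: eq_integral => z _; rewrite nneseriesZl_ge0.
Qed.

(** If [q] has constant mass [s < 1], the adjoint multiplies integrals by [s]
    and the Green operator multiplies them by [(1 - s)^-1]. *)
Lemma integral_green x (s : R) : (0 <= s < 1)%R ->
  (forall z, act lam q (cst 1) z = s%:E) ->
  (1 - s)%:E * \int[lam x]_h green F h = \int[lam x]_h F h.
Proof.
move=> s01 qs.
have [s0 s1] := andP s01.
have step i : \int[lam x]_h iter i (adjoint q) F h = (s ^+ i)%:E * \int[lam x]_h F h.
  elim: i => [|i ih]; first by rewrite expr0 mul1e.
  transitivity (\int[lam x]_h (adjoint q (iter i (adjoint q) F) h * cst 1 h)).
    by apply: eq_integral => h _; rewrite mule1.
  rewrite adjoint_duality//.
  under eq_integral do rewrite qs.
  rewrite ge0_integralZr ?lee_fin// ih exprS EFinM.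
  by rewrite muleC muleA.
rewrite /green integral_nneseries//.
rewrite -nneseriesZl; last by move=> i _; exact: integral_ge0.
under eq_eseriesr do rewrite step muleA -EFinM.
under eq_eseriesr do rewrite muleC.
rewrite nneseriesZl_ge0 ?eseries_geometric ?mule1//; first exact: integral_ge0.
by move=> j; rewrite lee_fin mulr_ge0 ?exprn_ge0// subr_ge0 ltW.
Qed.

End fixed_kernel.

End adjoint.

(** * Harmonic functions of a mixture of almost invariant kernels *)

Section harmonic_functions_constant.
Local Open Scope ereal_scope.
Context (R : realType) (dX dG : measure_display)
  (X : measurableType dX) (G : measurableType dG) (Gd : groupoid X G).
Hypothesis bG : borel_groupoid R Gd.
Variable lam : borel_system R Gd.
Hypothesis lam_proper : proper_system lam.

Let c (j : nat) : R := ((1 - 1 / 2) * (1 / 2) ^+ j)%R.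

Let c_ge0 j : (0 <= c j)%R.
Proof. by rewrite mulr_ge0 ?exprn_ge0//; lra. Qed.

Let cD i k : c (i + k)%N = ((1 / 2) ^+ k * c i)%R.
Proof. by rewrite /c exprD; ring. Qed.

Let sum_c : \sum_(j <oo) (c j)%:E = 1.
Proof. by apply: eseries_geometric; lra. Qed.

Variable T_ : (G * G -> \bar R)^nat.
Hypothesis TT : forall j, transition lam (T_ j).

Let T0 j p : 0 <= T_ j p. Proof. by case: (TT j). Qed.
Let mT j : measurable_fun [set: G * G] (T_ j). Proof. by case: (TT j). Qed.

Let d j := invariance_defect lam (T_ j).

Let d0 j h : 0 <= d j h. Proof. exact: invariance_defect_ge0. Qed.
Let md j : measurable_fun [set: G] (d j).
Proof. exact: measurable_invariance_defect. Qed.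

(** Up to its defect, the j-th kernel integrates [u] to the same value from [z]
    as from the unit. *)
Lemma act_le_unit_act x j u z : (forall h, 0 <= u h) -> measurable_fun [set: G] u ->
  (forall h, u h <= 1) -> tgt Gd z = x ->
  act lam (T_ j) u z <= act lam (T_ j) u (unit_arrow Gd x) + d j z /\
  act lam (T_ j) u (unit_arrow Gd x) <= act lam (T_ j) u z + d j z.
Proof.
move=> u0 mu u1 zx.
have ux : tgt Gd (unit_arrow Gd x) = x by rewrite tgt_unit.
pose y := unit_arrow Gd x.
have mfin w : measurable_fun [set: G] (fun h => fine (T_ j (w, h))).
  by apply: measurableT_comp => //; exact: measurable_section.
have fin_ae w : tgt Gd w = x -> {ae lam x, forall h, T_ j (w, h) < +oo}.
  move=> wx; apply: ae_lty_integral => //; first exact: measurable_section.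
  by rewrite -wx transition_mass// ltry.
have dE : d j z = \int[lam x]_h (`|fine (T_ j (y, h)) - fine (T_ j (z, h))|)%:E.
  by rewrite /d /invariance_defect zx.
have mabs : measurable_fun [set: G]
    (fun h => (`|fine (T_ j (y, h)) - fine (T_ j (z, h))|)%:E).
  by apply/measurable_EFinP; apply: measurableT_comp => //; exact: measurable_funB.
have key w w' : tgt Gd w = x -> tgt Gd w' = x ->
    {ae lam x, forall h, T_ j (w, h) * u h <= T_ j (w', h) * u h +
      (`|fine (T_ j (w', h)) - fine (T_ j (w, h))|)%:E}.
  move=> wx w'x; apply: filterS2 (fin_ae _ wx) (fin_ae _ w'x) => h h1 h2.
  have /fineK <- : T_ j (w, h) \is a fin_num by rewrite ge0_fin_numE.
  have /fineK <- : T_ j (w', h) \is a fin_num by rewrite ge0_fin_numE.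
  have /fineK <- : u h \is a fin_num.
    by rewrite ge0_fin_numE// (le_lt_trans (u1 h))// ltry.
  have v0 : (0 <= fine (u h))%R by rewrite fine_ge0.
  have v1 : (fine (u h) <= 1)%R.
    by rewrite -lee_fin fineK// ge0_fin_numE// (le_lt_trans (u1 h))// ltry.
  move: (fine (u h)) v0 v1 (fine (T_ j (w, h))) (fine (T_ j (w', h))) => v v0 v1 p q.
  rewrite -!EFinM -EFinD lee_fin /= -lerBlDl -mulrBl.
  apply: le_trans (ler_norm _) _; rewrite normrM (ger0_norm v0) distrC.
  by rewrite ler_piMr.
have main w w' : tgt Gd w = x -> tgt Gd w' = x ->
    act lam (T_ j) u w <= act lam (T_ j) u w' +
    \int[lam x]_h (`|fine (T_ j (w', h)) - fine (T_ j (w, h))|)%:E.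
  move=> wx w'x.
  have mabs' : measurable_fun [set: G]
      (fun h => (`|fine (T_ j (w', h)) - fine (T_ j (w, h))|)%:E).
    by apply/measurable_EFinP; apply: measurableT_comp => //; exact: measurable_funB.
  rewrite /act wx w'x -ge0_integralD//; last 2 first.
  - by move=> h _; rewrite mule_ge0.
  - exact: measurable_sectionM.
  apply: ae_ge0_le_integral => //.
  - by move=> h _; rewrite mule_ge0.
  - exact: measurable_sectionM.
  - by move=> h _; rewrite adde_ge0// mule_ge0.
  - by apply: emeasurable_funD => //; exact: measurable_sectionM.
  - by apply: filterS (key _ _ wx w'x) => h hh _.
split; rewrite dE; first exact: main.
under eq_integral do rewrite distrC.
exact: main.
Qed.

(** [q k] is the part of the mixture with indices below [k], and [Fk k] is the
    weight which absorbs it. *)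
Variables (q : nat -> G * G -> \bar R) (Fk : nat -> G -> \bar R).
Hypotheses (q0 : forall k p, 0 <= q k p)
  (mq : forall k, measurable_fun [set: G * G] (q k)).
Hypothesis act_q : forall k u z, (forall h, 0 <= u h) -> measurable_fun [set: G] u ->
  act lam (q k) u z = \sum_(j < k) ((c j)%:E * act lam (T_ j) u z).
Hypotheses (F00 : forall h, 0 < Fk 0%N h)
  (mFk : forall k, measurable_fun [set: G] (Fk k))
  (ndF : forall j k h, (j <= k)%N -> Fk j h <= Fk k h)
  (superF : forall k h, Fk 0%N h + adjoint lam (q k) (Fk k) h <= Fk k h).

Let Fk0 k h : 0 <= Fk k h.
Proof. by apply: le_trans (ltW (F00 h)) _; exact: ndF. Qed.

Let tau := geometric_mean (1 / 2)%R T_.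

Variable x : X.
Hypothesis Fk_fin : forall k, \int[lam x]_h Fk k h < +oo.
Hypothesis Fd_fin : \sum_(j <oo) \int[lam x]_h (Fk j h * d j h) < +oo.

Variable v : G -> R.
Hypotheses (mv : measurable_fun [set: G] v) (v01 : forall h, (0 <= v h <= 1)%R).
Hypothesis harm : {ae lam x, forall z, act lam tau (EFin \o v) z = (v z)%:E}.

Let V : G -> \bar R := EFin \o v.
Let V0 h : 0 <= V h. Proof. by rewrite lee_fin; case/andP: (v01 h). Qed.
Let V1 h : V h <= 1. Proof. by rewrite lee_fin; case/andP: (v01 h). Qed.
Let mV : measurable_fun [set: G] V. Proof. exact/measurable_EFinP. Qed.

Let a j := act lam (T_ j) V (unit_arrow Gd x).
Let a0 j : 0 <= a j. Proof. exact: act_ge0. Qed.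
Let a1 j : a j <= 1. Proof. exact: transition_le1. Qed.

(** As [c (i + k) = 2^-k c i], this is [2^k] times the sum of the [c j * a j]
    over [k <= j]. *)
Let AE k : \bar R := \sum_(i <oo) ((c i)%:E * a (i + k)%N).

Let AE0 k : 0 <= AE k.
Proof. by apply: nneseries_ge0 => i _ _; rewrite mule_ge0// lee_fin. Qed.

Let AE1 k : AE k <= 1.
Proof.
rewrite -sum_c; apply: lee_nneseries => [i _ _|i _].
  by rewrite mule_ge0// lee_fin.
by rewrite -[leRHS]mule1 lee_wpmul2l// lee_fin.
Qed.

Let A k : R := fine (AE k).

Let AK k : (A k)%:E = AE k.
Proof. by rewrite fineK// ge0_fin_numE// (le_lt_trans (AE1 k))// ltry. Qed.

Let A0 k : (0 <= A k)%R. Proof. by rewrite fine_ge0. Qed.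
Let A1 k : (A k <= 1)%R. Proof. by rewrite -lee_fin AK. Qed.

Let r k h : \bar R := \sum_(i <oo) ((c (i + k))%:E * d (i + k)%N h).

Let r0 k h : 0 <= r k h.
Proof. by apply: nneseries_ge0 => i _ _; rewrite mule_ge0// lee_fin. Qed.

Let mr k : measurable_fun [set: G] (r k).
Proof.
apply: ge0_emeasurable_sum => [i h _ _|i _]; first by rewrite mule_ge0// lee_fin.
exact: measurable_funeM.
Qed.

Let u k h : \bar R := (`|v h - A k|)%:E.
Let u0 k h : 0 <= u k h. Proof. by rewrite lee_fin. Qed.
Let mu k : measurable_fun [set: G] (u k).
Proof.
by apply/measurable_EFinP; apply: measurableT_comp => //; exact: measurable_funB.
Qed.

Let u1 k h : u k h <= 1.
Proof.
rewrite lee_fin ler_norml; have := v01 h; have := A0 k; have := A1 k; lra.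
Qed.

Let tail k z : \bar R := \sum_(i <oo) ((c (i + k))%:E * act lam (T_ (i + k)%N) V z).

Let harm_split k z : act lam tau V z = act lam (q k) V z + tail k z.
Proof.
rewrite act_q// act_geometric_mean//; last by lra.
rewrite (nneseries_split_shift k)// => j.
by apply: mule_ge0; [rewrite lee_fin; exact: c_ge0|exact: act_ge0].
Qed.

Let act_q_cst k (y : R) z : (0 <= y)%R ->
  act lam (q k) (cst y%:E) z + ((1 / 2) ^+ k * y)%:E = y%:E.
Proof.
move=> y0; rewrite act_q//.
under eq_bigr do rewrite transition_cst// -EFinM.
have s1 : y%:E = \sum_(j <oo) (y%:E * (c j)%:E).
  by rewrite nneseriesZl ?sum_c ?mule1// => j _; rewrite lee_fin.
rewrite [RHS]s1 (nneseries_split_shift k); last by move=> j; rewrite mule_ge0 ?lee_fin.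
congr (_ + _); first by apply: eq_bigr => j _; rewrite -EFinM mulrC.
under eq_eseriesr do rewrite cD muleC EFinM -muleA.
rewrite nneseriesZl; last by move=> j _; rewrite mule_ge0 ?lee_fin.
under eq_eseriesr do rewrite muleC.
rewrite nneseriesZl; last by move=> j _; rewrite lee_fin.
by rewrite sum_c mule1 EFinM.
Qed.

Let tail_le k z : tgt Gd z = x ->
  tail k z <= ((1 / 2) ^+ k * A k)%:E + r k z /\
  ((1 / 2) ^+ k * A k)%:E <= tail k z + r k z.
Proof.
move=> zx.
have EA : ((1 / 2) ^+ k * A k)%:E = \sum_(i <oo) ((c (i + k))%:E * a (i + k)%N).
  rewrite EFinM AK /AE -nneseriesZl; last by move=> i _; rewrite mule_ge0 ?lee_fin.
  by apply: eq_eseriesr => i _; rewrite muleA -EFinM cD.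
have P0 i : 0 <= act lam (T_ i) V z by exact: act_ge0.
have cP0 i (y : \bar R) : 0 <= y -> 0 <= (c i)%:E * y by move=> y0; rewrite mule_ge0 ?lee_fin.
rewrite EA /tail /r -!nneseriesD; try by move=> i _ _; exact: cP0.
have ck i := @act_le_unit_act x (i + k)%N V z V0 mV V1 zx.
split; apply: lee_nneseries => [i _ _|i _]; try exact: cP0.
  by rewrite -ge0_muleDr//; apply: lee_wpmul2l; rewrite ?lee_fin//; have [] := ck i.
by rewrite -ge0_muleDr//; apply: lee_wpmul2l; rewrite ?lee_fin//; have [] := ck i.
Qed.

Let V_le k h : V h <= (A k)%:E + u k h.
Proof. by rewrite -EFinD lee_fin addrC -lerBlDr; exact: ler_norm. Qed.

Let A_le k h : (A k)%:E <= V h + u k h.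
Proof. by rewrite -EFinD lee_fin addrC -lerBlDr distrC; exact: ler_norm. Qed.

(** Harmonicity splits [v] into [act (q k) v] and a tail within [r k] of the
    constant [2^-k A k], while [act (q k)] multiplies constants by [1 - 2^-k]. *)
Let u_le k z : act lam tau V z = V z -> tgt Gd z = x ->
  u k z <= act lam (q k) (u k) z + r k z.
Proof.
move=> hz zx.
have Ac0 h : 0 <= cst (A k)%:E h :> \bar R by rewrite lee_fin.
have qc := act_q_cst k z (A0 k).
have [tl1 tl2] := tail_le k zx.
set Y := act lam (q k) (u k) z + r k z.
have up : V z <= (A k)%:E + Y.
  rewrite -hz (harm_split k) -qc /Y addeACA; apply: leeD => //.
  rewrite -actD//; apply: le_act => //.
  - by move=> h; rewrite adde_ge0.
  - exact: emeasurable_funD.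
  - by apply: aeW => h; exact: V_le.
have lo : (A k)%:E <= V z + Y.
  rewrite -hz (harm_split k) -qc /Y addeACA; apply: leeD => //.
  rewrite -actD//; apply: le_act => //.
  - by move=> h; rewrite adde_ge0.
  - exact: emeasurable_funD.
  - by apply: aeW => h; exact: A_le.
have Y0 : 0 <= Y by rewrite adde_ge0// act_ge0.
move: Y0 up lo; rewrite /u /V /=; case: Y => [y|_ _ _|//]; last exact: leey.
rewrite -!EFinD !lee_fin => _ up lo; rewrite ler_norml; apply/andP; split; lra.
Qed.

(** Pair [u_le] with the weight [Fk k]: by duality the term with [q k] is the
    integral of [adjoint (q k) (Fk k) * u k], which [superF] removes. *)
Let int_u_le k : \int[lam x]_h (Fk 0%N h * u k h) <= \int[lam x]_h (Fk k h * r k h).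
Proof.
have adj0 h : 0 <= adjoint lam (q k) (Fk k) h by exact: adjoint_ge0.
have madj : measurable_fun [set: G] (adjoint lam (q k) (Fk k)) by exact: measurable_adjoint.
have mact : measurable_fun [set: G] (act lam (q k) (u k)) by exact: measurable_act.
have act0 h : 0 <= act lam (q k) (u k) h by exact: act_ge0.
have fibre_ae : {ae lam x, forall z, tgt Gd z = x}.
  exists (~` fibre Gd x); split => //.
    by apply: measurableC; exact: (measurable_fibre bG).
  exact: system_fibre.
have up : \int[lam x]_h (Fk k h * u k h) <=
    \int[lam x]_h (adjoint lam (q k) (Fk k) h * u k h) + \int[lam x]_h (Fk k h * r k h).
  rewrite adjoint_duality// -ge0_integralD//.
  - apply: ae_ge0_le_integral => //.
    + by move=> h _; rewrite mule_ge0.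
    + exact: emeasurable_funM.
    + by move=> h _; rewrite adde_ge0// mule_ge0.
    + by apply: emeasurable_funD; exact: emeasurable_funM.
    apply: filterS2 harm fibre_ae => h hh hx _.
    by rewrite -ge0_muleDr// lee_wpmul2l// u_le.
  - by move=> h _; rewrite mule_ge0.
  - exact: emeasurable_funM.
  - by move=> h _; rewrite mule_ge0.
  - exact: emeasurable_funM.
have lo : \int[lam x]_h (Fk 0%N h * u k h) +
    \int[lam x]_h (adjoint lam (q k) (Fk k) h * u k h) <= \int[lam x]_h (Fk k h * u k h).
  rewrite -ge0_integralD//.
  - apply: ge0_le_integral => //.
    + by move=> h _; rewrite adde_ge0// mule_ge0.
    + by apply: emeasurable_funD; exact: emeasurable_funM.
    + exact: emeasurable_funM.
    by move=> h _; rewrite -ge0_muleDl// lee_wpmul2r.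
  - by move=> h _; rewrite mule_ge0.
  - exact: emeasurable_funM.
  - by move=> h _; rewrite mule_ge0.
  - exact: emeasurable_funM.
have fin : \int[lam x]_h (adjoint lam (q k) (Fk k) h * u k h) \is a fin_num.
  rewrite ge0_fin_numE; last by apply: integral_ge0 => h _; rewrite mule_ge0.
  apply: le_lt_trans (Fk_fin k); apply: ge0_le_integral => //.
  - by move=> h _; rewrite mule_ge0.
  - exact: emeasurable_funM.
  move=> h _; apply: le_trans (superF k h); rewrite -[leLHS]add0e; apply: leeD => //.
  by rewrite -[leRHS]mule1 lee_wpmul2l.
by rewrite -(@leeD2lE _ _ _ _ fin) addeC; exact: le_trans lo up.
Qed.

Let Z := \sum_(j <oo) \int[lam x]_h (Fk j h * d j h).

(** For [j >= k] the weight [Fk k] is below [Fk j], against which the j-th defect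
    is controlled. *)
Let int_r_le k : \int[lam x]_h (Fk k h * r k h) <= ((1 / 2) ^+ k)%:E * Z.
Proof.
have mFd j l : measurable_fun [set: G] (fun h => Fk j h * d l h) by exact: emeasurable_funM.
have I0 j : 0 <= \int[lam x]_h (Fk j h * d j h).
  by apply: integral_ge0 => h _; rewrite mule_ge0.
have Z0 : 0 <= Z by exact: nneseries_ge0.
have -> : \int[lam x]_h (Fk k h * r k h) =
    \sum_(i <oo) ((c (i + k))%:E * \int[lam x]_h (Fk k h * d (i + k)%N h)).
  transitivity (\int[lam x]_h \sum_(i <oo) ((c (i + k))%:E * (Fk k h * d (i + k)%N h))).
    apply: eq_integral => h _; rewrite /r -nneseriesZl_ge0//.
      by apply: eq_eseriesr => i _; rewrite muleCA.
    by move=> i; rewrite mule_ge0// lee_fin.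
  rewrite integral_nneseries//; last 2 first.
  - by move=> i; exact: measurable_funeM.
  - by move=> i h _; rewrite mule_ge0 ?lee_fin// mule_ge0.
  apply: eq_eseriesr => i _; rewrite ge0_integralZl// ?lee_fin//.
  by move=> h _; rewrite mule_ge0.
apply: (@le_trans _ _ (\sum_(i <oo) (((1 / 2) ^+ k)%:E * Z * (c i)%:E))).
  apply: lee_nneseries => [i _ _|i _].
    rewrite mule_ge0 ?lee_fin//; apply: integral_ge0 => h _; exact: mule_ge0.
  rewrite cD EFinM -muleA -muleA lee_wpmul2l ?lee_fin ?exprn_ge0//.
  rewrite muleC lee_wpmul2r ?lee_fin//.
  apply: (@le_trans _ _ (\int[lam x]_h (Fk (i + k)%N h * d (i + k)%N h))).
    apply: ge0_le_integral => //.
    - by move=> h _; rewrite mule_ge0.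
    - by move=> h _; rewrite lee_wpmul2r// ndF// leq_addl.
  rewrite /Z [leRHS](@nneseriesD1 _ _ (i + k)%N)// leeDl//.
  exact: nneseries_ge0.
rewrite nneseriesZl_ge0 ?sum_c ?mule1//.
by rewrite mule_ge0// lee_fin exprn_ge0.
Qed.

(** The integrals of [F_0 |v - A k|] are summable in [k], so [A k] converges to
    [v z] for almost every [z]. *)
Lemma harmonic_constant : exists y : R, {ae lam x, forall z, v z = y}.
Proof.
have Z0 : 0 <= Z.
  apply: nneseries_ge0 => j _ _; apply: integral_ge0 => h _; exact: mule_ge0.
have /ae_weighted_summable : \sum_(k <oo) \int[lam x]_h (Fk 0%N h * u k h) < +oo.
  apply: (@le_lt_trans _ _ (\sum_(k <oo) (2%:E * Z * (c k)%:E))).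
    apply: lee_nneseries => [k _ _|k _].
      by apply: integral_ge0 => h _; rewrite mule_ge0.
    apply: le_trans (int_u_le k) _; apply: le_trans (int_r_le k) _.
    rewrite -muleA [Z * _]muleC muleA -EFinM; apply: lee_wpmul2r => //.
    by rewrite lee_fin /c; move: ((1 / 2) ^+ k)%R => e; lra.
  rewrite nneseriesZl_ge0 ?sum_c ?mule1//; last by rewrite mule_ge0.
  by rewrite -[Z]fineK ?ge0_fin_numE// -EFinM ltry.
move=> /(_ F00 (mFk 0%N) u0 mu) h.
exists (lim (A @ \oo)); apply: filterS h => z uz.
apply/esym/cvg_lim => //.
have b0 : (`|A k - v z|)%R @[k --> \oo] --> (0 : R)%R.
  apply: cvg_series_cvg_0; apply: cvgn_series_summable => //.
  by under eq_eseriesr do rewrite distrC.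
apply/cvgrPdist_le => e e0; have /cvgr0Pnorm_le/(_ _ e0) := b0.
by apply: filterS => k; rewrite normr_id distrC.
Qed.

End harmonic_functions_constant.

(** * Choice of the kernels of the mixture *)

Section selection.
Local Open Scope ereal_scope.
Context (R : realType) (dX dG : measure_display)
  (X : measurableType dX) (G : measurableType dG) (Gd : groupoid X G).
Hypothesis bG : borel_groupoid R Gd.
Variable lam : borel_system R Gd.
Hypothesis lam_proper : proper_system lam.
Variable mu : {measure set X -> \bar R}.

Lemma ae_fibre_integral_lty (F : G -> \bar R) : (forall h, 0 <= F h) ->
  measurable_fun [set: G] F -> \int[star mu lam]_h F h < +oo ->
  {ae mu, forall x, \int[lam x]_h F h < +oo}.
Proof.
move=> F0 mF; rewrite integral_star// => Foo.
apply: ae_lty_integral => //; first by move=> x; exact: integral_ge0.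
exact: measurable_system_integral.
Qed.

Variable t_ : (G * G -> \bar R)^nat.
Hypothesis tt : forall n, transition lam (t_ n).

Let t0 n p : 0 <= t_ n p. Proof. by case: (tt n). Qed.
Let mt n : measurable_fun [set: G * G] (t_ n). Proof. by case: (tt n). Qed.

Let d n := invariance_defect lam (t_ n).
Let d0 n h : 0 <= d n h. Proof. exact: invariance_defect_ge0. Qed.
Let md n : measurable_fun [set: G] (d n). Proof. exact: measurable_invariance_defect. Qed.

Let integrable_weight (F : G -> \bar R) := [/\ forall h, 0 <= F h,
  measurable_fun [set: G] F & \int[star mu lam]_h F h < +oo].

Hypothesis vanishing : forall F, integrable_weight F -> forall e : R, (0 < e)%R ->
  exists n, \int[star mu lam]_h (F h * d n h) <= e%:E.

Variable F0 : G -> \bar R.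
Hypotheses (F0_gt0 : forall h, 0 < F0 h) (F0_ok : integrable_weight F0).

Let c (j : nat) : R := ((1 - 1 / 2) * (1 / 2) ^+ j)%R.

Let c_gt0 j : (0 < c j)%R.
Proof. by rewrite mulr_gt0 ?exprn_gt0//; lra. Qed.

Section with_pick.
Variable pick : nat * (G -> \bar R) -> nat.
Hypothesis pickP : forall kF, integrable_weight kF.2 ->
  \int[star mu lam]_h (kF.2 h * d (pick kF) h) <= (c kF.1)%:E.

(** A stage holds the weight and the partial mixture [q]; the next kernel is
    picked in terms of the weight only, then added to [q], and the new weight is
    the Green function of the new [q]. *)
Fixpoint stage (k : nat) : (G -> \bar R) * (G * G -> \bar R) :=
  if k is k'.+1 then
    let q := fun p => (stage k').2 p + (c k')%:E * t_ (pick (k', (stage k').1)) p in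
    (green lam q (stage k').1, q)
  else (F0, cst 0).

Let letter k := pick (k, (stage k).1).
Let q k := (stage k).2.
Let F k := (stage k).1.

Let q0 k p : 0 <= q k p.
Proof.
elim: k => // k ih; rewrite /q/= adde_ge0// mule_ge0// lee_fin; exact: ltW.
Qed.

Let mq k : measurable_fun [set: G * G] (q k).
Proof.
elim: k => [|k ih]; first exact: measurable_cst.
by apply: emeasurable_funD => //; exact: measurable_funeM.
Qed.

Let act_q k u z : (forall h, 0 <= u h) -> measurable_fun [set: G] u ->
  act lam (q k) u z = \sum_(j < k) ((c j)%:E * act lam (t_ (letter j)) u z).
Proof.
move=> u0 mu'; elim: k => [|k ih].
  by rewrite big_ord0; apply: integral0_eq => h _; rewrite mul0e.
rewrite big_ord_recr/= -ih /act -[(c k)%:E * _]ge0_integralZl//; last 3 first.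
- exact: measurable_sectionM.
- by move=> h _; rewrite mule_ge0.
- by rewrite lee_fin ltW.
rewrite -ge0_integralD//.
- apply: eq_integral => h _; rewrite muleA.
  have C0 : 0 <= (c k)%:E * t_ (letter k) (z, h) by rewrite mule_ge0// lee_fin ltW.
  by rewrite -(ge0_muleDl _ (q0 k (z, h)) C0).
- by move=> h _; rewrite mule_ge0.
- exact: measurable_sectionM.
- by move=> h _; rewrite mule_ge0 ?lee_fin ?(ltW (c_gt0 k))// mule_ge0.
- by apply: measurable_funeM; exact: measurable_sectionM.
Qed.

Let mass_q k z : act lam (q k) (cst 1) z = (1 - (1 / 2) ^+ k)%:E.
Proof.
rewrite act_q//; elim: k => [|k ih]; first by rewrite big_ord0 expr0 subrr.
rewrite big_ord_recr/= ih; have [_ _ -> _] := tt (letter k).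
by rewrite mule1 -EFinD; congr EFin; rewrite /c exprS; lra.
Qed.

Let mass01 k : (0 <= 1 - (1 / 2 : R) ^+ k < 1)%R.
Proof.
have h0 : (0 < (1 / 2) ^+ k :> R)%R by rewrite exprn_gt0.
have h1 : ((1 / 2) ^+ k <= 1 :> R)%R by rewrite exprn_ile1//; lra.
by apply/andP; split; lra.
Qed.

(** [q k.+1] has mass [1 - 2^-(k+1)], so the integral of the weight is multiplied
    by [2^(k+1)] and stays finite. *)
Let F_ok k : integrable_weight (F k).
Proof.
elim: k => // k [Fk0 mFk Fkoo].
have G0 h : 0 <= green lam (q k.+1) (F k) h by exact: green_ge0.
have mG : measurable_fun [set: G] (green lam (q k.+1) (F k)) by exact: measurable_green.
split => //; rewrite -/(q k.+1) integral_star//.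
have h2 : (0 < (1 / 2) ^+ k.+1 :> R)%R by rewrite exprn_gt0.
have E x : ((1 / 2) ^+ k.+1)%:E * \int[lam x]_h green lam (q k.+1) (F k) h =
    \int[lam x]_h F k h.
  rewrite -(integral_green bG lam_proper (q0 k.+1) (mq k.+1) Fk0 mFk x (mass01 k.+1)).
    by congr (_%:E * _); lra.
  exact: mass_q.
have : ((1 / 2) ^+ k.+1)%:E * \int[mu]_x \int[lam x]_h green lam (q k.+1) (F k) h < +oo.
  rewrite -ge0_integralZl//.
  - under eq_integral do rewrite E.
    by rewrite -integral_star.
  - exact: measurable_system_integral.
  - by move=> x _; exact: integral_ge0.
have : 0 <= \int[mu]_x \int[lam x]_h green lam (q k.+1) (F k) h.
  by apply: integral_ge0 => x _; exact: integral_ge0.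
case: (\int[mu]_x _) => [y _ _|_|//]; first exact: ltry.
by rewrite gt0_muley.
Qed.

Let Fk0 k h : 0 <= F k h. Proof. by case: (F_ok k). Qed.
Let mF k : measurable_fun [set: G] (F k). Proof. by case: (F_ok k). Qed.

Let FE k h : F k.+1 h = F k h + adjoint lam (q k.+1) (F k.+1) h.
Proof. exact: (greenE bG lam_proper (q0 k.+1) (mq k.+1) (Fk0 k) (mF k) h). Qed.

Let adj0 k h : 0 <= adjoint lam (q k) (F k) h. Proof. exact: adjoint_ge0. Qed.

Let ndF j k h : (j <= k)%N -> F j h <= F k h.
Proof.
elim: k => [|k ih]; first by rewrite leqn0 => /eqP ->.
rewrite leq_eqVlt => /predU1P[-> //|]; rewrite ltnS => /ih Fj.
by apply: le_trans Fj _; rewrite FE leeDl.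
Qed.

Let superF k h : F 0%N h + adjoint lam (q k) (F k) h <= F k h.
Proof.
case: k => [|k]; last by rewrite [leRHS]FE; apply: leeD => //; exact: ndF.
rewrite [adjoint _ _ _ _](_ : _ = 0) ?adde0//.
by apply: integral0_eq => z _; rewrite mul0e.
Qed.

(** The defects are controlled in the mean over all fibres; the sum of their
    integrals is therefore finite on almost every single fibre. *)
Lemma selected_letters_harmonic : {ae mu, forall x, forall v : G -> R,
  measurable_fun [set: G] v -> (forall h, (0 <= v h <= 1)%R) ->
  {ae lam x, forall z,
    act lam (geometric_mean (1 / 2)%R (t_ \o letter)) (EFin \o v) z = (v z)%:E} ->
  exists y : R, {ae lam x, forall z, v z = y}}.
Proof.
have Fd0 j h : 0 <= F j h * d (letter j) h by rewrite mule_ge0.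
have mFd j : measurable_fun [set: G] (fun h => F j h * d (letter j) h).
  exact: emeasurable_funM.
have ae1 : {ae mu, forall x, forall k, \int[lam x]_h F k h < +oo}.
  by apply/ae_foralln => k; have [_ _ Foo] := F_ok k; exact: ae_fibre_integral_lty.
have ae2 : {ae mu, forall x, \sum_(j <oo) \int[lam x]_h (F j h * d (letter j) h) < +oo}.
  have : {ae mu, forall x,
      \int[lam x]_h (\sum_(j <oo) (F j h * d (letter j) h)) < +oo}.
    apply: ae_fibre_integral_lty.
    - by move=> h; exact: nneseries_ge0.
    - exact: ge0_emeasurable_sum.
    rewrite integral_nneseries//.
    apply: (@le_lt_trans _ _ (\sum_(j <oo) (c j)%:E)).
      apply: lee_nneseries => [j _ _|j _]; first exact: integral_ge0.
      by apply: (pickP (kF := (j, F j))); exact: F_ok.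
    by rewrite eseries_geometric ?ltry//; lra.
  by apply: filterS => x; rewrite integral_nneseries.
apply: filterS2 ae1 ae2 => x h1 h2 v mv v01 hv.
exact: (@harmonic_constant _ _ _ _ _ _ bG lam lam_proper (t_ \o letter)
  (fun j => tt (letter j)) q F q0 mq act_q F0_gt0 mF ndF superF x h1 h2 v mv v01 hv).
Qed.

End with_pick.

Lemma exists_mean_with_constant_harmonics : exists l : nat -> nat, {ae mu, forall x,
  forall v : G -> R, measurable_fun [set: G] v -> (forall h, (0 <= v h <= 1)%R) ->
  {ae lam x, forall z,
    act lam (geometric_mean (1 / 2)%R (t_ \o l)) (EFin \o v) z = (v z)%:E} ->
  exists y : R, {ae lam x, forall z, v z = y}}.
Proof.
have hpick (kF : nat * (G -> \bar R)) : exists n, integrable_weight kF.2 ->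
    \int[star mu lam]_h (kF.2 h * d n h) <= (c kF.1)%:E.
  have [wF|nwF] := pselect (integrable_weight kF.2); last by exists 0%N.
  by have [n hn] := vanishing wF (c_gt0 kF.1); exists n.
have [pick pickP] := choice hpick.
by eexists; exact: (selected_letters_harmonic pickP).
Qed.

End selection.

(** * Complex functions and the Markov operator *)

Section complex_convergence.
Local Open Scope complex_scope.
Context (R : realType).

Lemma normc_le_ReIm (z : R[i]) :
  ComplexField.Normc.normc z <= `|complex.Re z| + `|complex.Im z|.
Proof.
case: z => a b /=; rewrite -(ler_sqr (x := Num.sqrt _)) ?nnegrE ?addr_ge0//.
rewrite sqr_sqrtr ?addr_ge0 ?sqr_ge0// sqrrD !real_normK ?num_real//.
by rewrite lerD2r lerDl mulrn_wge0// mulr_ge0.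
Qed.

Lemma cvg_complex0 (a b : R^nat) :
  a @ \oo --> (0 : R) -> b @ \oo --> (0 : R) ->
  (fun n => (a n +i* b n) : R[i]^o) @ \oo --> (0 : R[i]^o).
Proof.
move=> ha hb; apply/cvgr0Pnorm_le => e; rewrite ltcE/= => /andP[/eqP e0 e1].
have e2 : 0 < complex.Re e / 2 by rewrite divr_gt0.
have /cvgr0Pnorm_le/(_ _ e2) := ha; have /cvgr0Pnorm_le/(_ _ e2) := hb.
apply: filterS2 => n hbn han; rewrite lecE/= e0 eqxx/=.
apply: (@le_trans _ _ (`|a n| + `|b n|)); last by lra.
exact: (@normc_le_ReIm (a n +i* b n)).
Qed.

Lemma cvg_Re0 (z : nat -> R[i]) : (z : nat -> R[i]^o) @ \oo --> (0 : R[i]^o) ->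
  (fun n => complex.Re (z n)) @ \oo --> (0 : R).
Proof.
move=> hz; apply/cvgr0Pnorm_le => e e0.
have e0' : 0 < e%:C :> R[i]^o by rewrite ltcE/= eqxx.
have /cvgr0Pnorm_le/(_ _ e0') := hz.
apply: filterS => n hn; have := le_trans (normc_ge_Re (z n)) hn.
by rewrite lecE/= => /andP[].
Qed.

End complex_convergence.

Section markov_operator.
Context (R : realType) (dX dG : measure_display)
  (X : measurableType dX) (G : measurableType dG) (Gd : groupoid X G).
Hypothesis bG : borel_groupoid R Gd.
Variable lam : borel_system R Gd.
Variables (theta : borel_system R Gd) (t : G * G -> \bar R).
Hypotheses (tt : transition lam t) (rep : represents lam theta t).
Hypothesis theta1 : forall x, theta x [set: G] = 1%E.

Let t0 p : (0 <= t p)%E. Proof. by case: tt. Qed.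
Let mt : measurable_fun [set: G * G] t. Proof. by case: tt. Qed.
Let mfibre x : measurable (fibre Gd x). Proof. exact: (measurable_fibre bG). Qed.

Definition real_markov (w : G -> R) (g : G) : R :=
  Rintegral (theta (src Gd g)) (fibre Gd (src Gd g)) (fun h => w (gcomp Gd g h)).

Let mcomp (w : G -> R) g : measurable_fun (fibre Gd (tgt Gd g)) w ->
  measurable_fun (fibre Gd (src Gd g)) (fun h => w (gcomp Gd g h)).
Proof.
move=> mw; apply: (measurable_comp (mfibre (tgt Gd g))) mw _.
  by move=> _ [h hf <-]; rewrite /fibre/= tgt_comp.
exact: (measurable_left_mul bG).
Qed.

(** The push-forward of [theta^(src g)] by [g] has a density. *)
Lemma real_markov_ae_eq (w w' : G -> R) g :
  measurable_fun (fibre Gd (tgt Gd g)) w -> measurable_fun (fibre Gd (tgt Gd g)) w' ->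
  ae_eq (lam (tgt Gd g)) (fibre Gd (tgt Gd g)) w w' ->
  real_markov w g = real_markov w' g.
Proof.
move=> mw mw' [N [mN N0 sN]]; rewrite /real_markov /Rintegral; congr fine.
apply: ae_eq_integral => //.
- by apply/measurable_EFinP; exact: mcomp.
- by apply/measurable_EFinP; exact: mcomp.
exists (fibre Gd (src Gd g) `&` gcomp Gd g @^-1` N); split.
- by apply: (measurable_left_mul bG).
- have := translateE bG theta g mN; rewrite /translate => ->.
  rewrite -rep//; last by apply/measurable_EFinP; exact: measurable_indic.
  rewrite act_indic//; apply: null_set_integral => //.
  by apply: measurable_funTS; exact: measurable_section.
- move=> h /= /not_implyP[hf hne]; split => //; apply: sN => /=.
  apply/not_implyP; split; first by rewrite /fibre/= tgt_comp.
  by move=> e; apply: hne; rewrite /= e.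
Qed.

Let ifibre (w : G -> R) g M : measurable_fun (fibre Gd (tgt Gd g)) w ->
  (forall h, `|w h| <= M) ->
  (theta (src Gd g)).-integrable (fibre Gd (src Gd g))
    (EFin \o (fun h => w (gcomp Gd g h))).
Proof.
move=> mw wM; apply: measurable_bounded_integrable => //.
- apply: (@le_lt_trans _ _ (theta (src Gd g) [set: G])); last by rewrite theta1 ltry.
  by apply: measure_mono.
- exact: mcomp.
- exists M; split; first exact: num_real.
  by move=> y My h _ /=; apply: le_trans (wM _) (ltW My).
Qed.

Let theta_fibre1 x : theta x (fibre Gd x) = 1%E.
Proof.
rewrite -(theta1 x) -(setUv (fibre Gd x)) measureU//.
- by rewrite [X in (_ + X)%E](_ : _ = 0%E) ?adde0//; exact: system_fibre.
- exact: measurableC.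
- by rewrite setICr.
Qed.

Lemma real_markov_affine (v : G -> R) (a b : R) g :
  measurable_fun [set: G] v -> (forall h, 0 <= v h <= 1) ->
  real_markov (fun h => a * v h + b) g = a * fine (act lam t (EFin \o v) g) + b.
Proof.
move=> mv v01.
have mvf : measurable_fun (fibre Gd (tgt Gd g)) v by exact: measurable_funTS.
have iv : (theta (src Gd g)).-integrable (fibre Gd (src Gd g))
    (EFin \o (fun h => v (gcomp Gd g h))).
  apply: (ifibre (M := 1)) => // h; have /andP[v0 v1] := v01 h.
  by rewrite ger0_norm.
have iav : (theta (src Gd g)).-integrable (fibre Gd (src Gd g))
    (EFin \o (fun h => a * v (gcomp Gd g h))).
  rewrite (_ : EFin \o _ = (fun h => a%:E * (EFin \o (fun h => v (gcomp Gd g h))) h)%E).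
    exact: integrableZl.
  by apply/funext => h /=; rewrite EFinM.
have ib : (theta (src Gd g)).-integrable (fibre Gd (src Gd g)) (EFin \o cst b).
  by apply: (ifibre (w := cst b) (M := `|b|)).
rewrite /real_markov RintegralD// RintegralZl// Rintegral_cst//.
rewrite theta_fibre1 mulr1; congr (_ * _ + _).
rewrite rep//; last 2 first.
- by move=> h; rewrite lee_fin; case/andP: (v01 h).
- exact/measurable_EFinP.
by rewrite /Rintegral integral_mkcond.
Qed.

Lemma Re_markov (f : G -> R[i]) g :
  complex.Re (Defs.markov theta f g) = real_markov (fun h => complex.Re (f h)) g.
Proof. by []. Qed.

Lemma Im_markov (f : G -> R[i]) g :
  complex.Im (Defs.markov theta f g) = real_markov (fun h => complex.Im (f h)) g.
Proof. by []. Qed.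

Variable x : X.
Hypothesis harmonic_cst : forall v : G -> R, measurable_fun [set: G] v ->
  (forall h, 0 <= v h <= 1) ->
  {ae lam x, forall z, act lam t (EFin \o v) z = (v z)%:E} ->
  exists y : R, {ae lam x, forall z, v z = y}.

Let fibre_ae : {ae lam x, forall z, tgt Gd z = x}.
Proof.
exists (~` fibre Gd x); split => //; first exact: measurableC.
exact: system_fibre.
Qed.

(** Truncating [w] at a bound that holds almost everywhere changes it on a null
    set only, which the Markov operator does not see; rescaling to the unit
    interval commutes with that operator. *)
Lemma real_harmonic_constant (w : G -> R) (M : R) :
  measurable_fun (fibre Gd x) w ->
  {ae lam x, forall h, fibre Gd x h -> `|w h| <= M} ->
  ae_eq (lam x) (fibre Gd x) (real_markov w) w ->
  exists y : R, ae_eq (lam x) (fibre Gd x) w (cst y).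
Proof.
move=> mw wM hw.
pose M' := Num.max M 1.
have M'0 : 0 < M' by rewrite lt_max ltr01 orbT.
pose cl h := Num.max (- M') (Num.min M' (w h)).
pose v := (fun h => (cl h + M') / (2 * M')) \_ (fibre Gd x).
have mcl : measurable_fun (fibre Gd x) cl.
  by apply: measurable_maxr => //; exact: measurable_minr.
have mv : measurable_fun [set: G] v.
  apply/measurable_restrict => //; rewrite setTI.
  by apply: measurable_funM => //; exact: measurable_funD.
have v01 h : 0 <= v h <= 1.
  rewrite /v patchE; case: ifP => [_|_]; last by rewrite -[point]/(0 : R) lexx ler01.
  have c1 : - M' <= cl h by rewrite le_max lexx.
  have c2 : cl h <= M' by rewrite ge_max ge_min lexx; apply/andP; split => //; lra.
  rewrite divr_ge0/= ?ler_pdivrMr; lra.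
have wv : ae_eq (lam x) (fibre Gd x) w (fun h => 2 * M' * v h + - M').
  apply: filterS wM => h hM hf; rewrite /v patchE mem_set//.
  have : `|w h| <= M' by rewrite (le_trans (hM hf))// le_max lexx.
  rewrite ler_norml => /andP[w1 w2].
  rewrite /cl (min_idPr w2) (max_idPr w1) mulrCA mulfV ?mulr1 ?addrK//.
  by rewrite gt_eqF// mulr_gt0.
have mwv : measurable_fun (fibre Gd x) (fun h => 2 * M' * v h + - M').
  by apply: measurable_funTS; apply: measurable_funD => //; exact: measurable_funM.
have actv : {ae lam x, forall z, act lam t (EFin \o v) z = (v z)%:E}.
  have wv' := wv; have := fibre_ae; apply: filterS3 hw wv => z hz wz zx.
  have zf : fibre Gd x z by [].
  have := hz zf; rewrite (@real_markov_ae_eq w (fun h => 2 * M' * v h + - M') z); last 3 first.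
  - by rewrite zx.
  - by rewrite zx.
  - by rewrite zx; exact: wv'.
  rewrite real_markov_affine// (wz zf) => /addIr.
  have M2 : 2 * M' != 0 by rewrite gt_eqF// mulr_gt0.
  move=> /(mulfI M2) <-; rewrite fineK// ge0_fin_numE.
    apply: (@le_lt_trans _ _ 1%E); last exact: ltry.
    apply: (transition_le1 z tt) => [h||h]; rewrite ?lee_fin.
    - by case/andP: (v01 h).
    - exact/measurable_EFinP.
    - by case/andP: (v01 h).
  by apply: act_ge0 => // h; rewrite lee_fin; case/andP: (v01 h).
have [y vy] := harmonic_cst mv v01 actv.
exists (2 * M' * y + - M'); apply: filterS2 wv vy => h hw' hv hf.
by rewrite hw'// hv.
Qed.

Lemma harmonicP (f : G -> R[i]) : Defs.Linfty (lam x) (fibre Gd x) f ->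
  (Defs.harmonic lam theta x f <->
   exists c : R[i], ae_eq (lam x) (fibre Gd x) f (cst c)).
Proof.
move=> Lf; have [[mRe mIm] [M fM]] := Lf; split.
  move=> [_ hf].
  have reM : {ae lam x, forall h, fibre Gd x h -> `|complex.Re (f h)| <= M}.
    apply: filterS fM => h hM hf'; apply: le_trans (hM hf').
    have := normc_ge_Re (f h); rewrite lecE/= => /andP[_].
    by case: (f h).
  have imM : {ae lam x, forall h, fibre Gd x h -> `|complex.Im (f h)| <= M}.
    apply: filterS fM => h hM hf'; apply: le_trans (hM hf').
    case: (f h) => a b /=; rewrite -sqrtr_sqr ler_wsqrtr// lerDr sqr_ge0//.
  have [|y1 h1] := @real_harmonic_constant (fun h => complex.Re (f h)) M mRe reM.
    by apply: filterS hf => z hz /hz; rewrite -Re_markov => ->.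
  have [|y2 h2] := @real_harmonic_constant (fun h => complex.Im (f h)) M mIm imM.
    by apply: filterS hf => z hz /hz; rewrite -Im_markov => ->.
  exists (complex.Complex y1 y2); apply: filterS2 h1 h2 => h e1 e2 hf'.
  by have := e1 hf'; have := e2 hf'; case: (f h) => a b /= -> ->.
move=> [[y1 y2] hc]; split => //.
have aff (y : R) g : real_markov (cst y) g = y.
  transitivity (real_markov (fun h => 0 * cst 0 h + y) g).
    by congr (real_markov _ g); apply/funext => h; rewrite mul0r add0r.
  rewrite real_markov_affine ?mul0r ?add0r//.
  by move=> h; rewrite lexx ler01.
have hc' := hc; apply: filterS2 hc fibre_ae => z hz zx zf; rewrite (hz zf)/=.
have E1 : complex.Re (Defs.markov theta f z) = y1.
  rewrite Re_markov -[RHS](aff y1 z); apply: real_markov_ae_eq; rewrite ?zx//.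
  by apply: filterS hc' => h hh /hh ->.
have E2 : complex.Im (Defs.markov theta f z) = y2.
  rewrite Im_markov -[RHS](aff y2 z); apply: real_markov_ae_eq; rewrite ?zx//.
  by apply: filterS hc' => h hh /hh ->.
by case: (Defs.markov theta f z) E1 E2 => a b /= -> ->.
Qed.

End markov_operator.

(** * The equivalence *)

Lemma bounded_cvg_Rintegral d (T : measurableType d) (R : realType)
    (m : {measure set T -> \bar R}) (D : nat -> T -> R) (phi : T -> R) (M : R) :
  measurable_fun [set: T] phi -> (\int[m]_x (`|phi x|)%:E < +oo)%E ->
  (forall n, measurable_fun [set: T] (D n)) -> (forall n x, `|D n x| <= M) ->
  {ae m, forall x, D n x @[n --> \oo] --> (0 : R)} ->
  (fun n => Rintegral m [set: T] (fun x => D n x * phi x)) @ \oo --> (0 : R).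
Proof.
move=> mphi iphi mD DM D0.
have mDp n : measurable_fun [set: T] (fun x => (D n x * phi x)%:E).
  by apply/measurable_EFinP; exact: measurable_funM.
have [||||_ _] := @dominated_convergence _ T R m [set: T] measurableT
  (fun n x => (D n x * phi x)%:E) (cst 0%E) (fun x => (M * `|phi x|)%:E) mDp.
- exact: measurable_cst.
- apply: filterS D0 => x Dx _; apply: cvg_EFin; first exact: nearW.
  by rewrite -[X in _ --> X](mul0r (phi x)); apply: cvgMl.
- rewrite (_ : (fun x => (M * `|phi x|)%:E) = (fun x => M%:E * (`|phi x|)%:E)%E).
    apply: integrableZl => //; apply/integrableP; split.
      by apply/measurable_EFinP; exact: measurableT_comp.
    by under eq_integral do rewrite /= normr_id.
  by apply/funext => x; rewrite EFinM.
- by apply: aeW => x n _; rewrite /= normrM lee_fin ler_wpM2r.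
rewrite integral0 => h.
by rewrite /Rintegral; apply: fine_cvg; exact: h.
Qed.

Section equivalence.
Context (R : realType) (dX dG : measure_display)
  (X : measurableType dX) (G : measurableType dG) (Gd : groupoid X G).
Hypothesis bG : borel_groupoid R Gd.
Variable lam : borel_system R Gd.
Hypothesis lam_proper : proper_system lam.
Variable mu : {measure set X -> \bar R}.
Hypothesis mu_sf : sigma_finite [set: X] mu.

Lemma invariance_defect_le2 t g : transition lam t ->
  (invariance_defect lam t g <= 2%:E)%E.
Proof.
move=> tt; have [t0 mt _ _] := tt.
have ux : tgt Gd (unit_arrow Gd (tgt Gd g)) = tgt Gd g by rewrite tgt_unit.
have u1 : (\int[lam (tgt Gd g)]_h t (unit_arrow Gd (tgt Gd g), h) = 1)%E.
  by have := transition_mass (unit_arrow Gd (tgt Gd g)) tt; rewrite ux.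
have [|||||B mB] := @density_distance_upper_set _ G R (lam (tgt Gd g))
    (fun h => t (unit_arrow Gd (tgt Gd g), h)) (fun h => t (g, h)) _ _ _ _ u1.
- by [].
- by [].
- exact: measurable_section.
- exact: measurable_section.
- exact: transition_mass.
rewrite /invariance_defect => ->.
rewrite -[leRHS]mule1; apply: lee_wpmul2l => //.
have h1 : (\int[lam (tgt Gd g)]_(h in B) t (unit_arrow Gd (tgt Gd g), h) <= 1)%E.
  rewrite -u1; apply: ge0_subset_integral => //.
  exact: measurable_section.
apply: le_trans h1; rewrite leeBlDr.
  by rewrite leeDl//; apply: integral_ge0.
rewrite ge0_fin_numE; last exact: integral_ge0.
apply: (@le_lt_trans _ _ 1%E); last exact: ltry.
rewrite -(transition_mass g tt); apply: ge0_subset_integral => //.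
exact: measurable_section.
Qed.

Lemma liouville_real_harmonic (theta : borel_system R Gd) t x :
  transition lam t -> represents lam theta t ->
  (forall y, theta y [set: G] = 1%E) ->
  (forall f : G -> R[i], Defs.Linfty (lam x) (fibre Gd x) f ->
    (Defs.harmonic lam theta x f <->
     exists c : R[i], ae_eq (lam x) (fibre Gd x) f (cst c))) ->
  forall v : G -> R, measurable_fun [set: G] v -> (forall h, 0 <= v h <= 1) ->
  {ae lam x, forall z, act lam t (EFin \o v) z = (v z)%:E} ->
  exists y : R, {ae lam x, forall z, v z = y}.
Proof.
move=> tt rep theta1 hL v mv v01 hv.
pose f h : R[i] := complex.Complex (v h) 0.
have Lf : Defs.Linfty (lam x) (fibre Gd x) f.
  split; first by split; [exact: measurable_funTS|exact: measurable_cst].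
  exists 1; apply: aeW => h _; apply: le_trans (normc_le_ReIm _) _ => /=.
  by have /andP[v0 v1] := v01 h; rewrite normr0 addr0 ger0_norm.
have aff := real_markov_affine bG rep theta1.
have [hf _] := hL f Lf.
have [|[y1 y2] hy] := hf.
  split => //; apply: filterS hv => z hz _.
  have E1 : complex.Re (Defs.markov theta f z) = v z.
    rewrite Re_markov -[RHS]/(fine (v z)%:E) -hz.
    transitivity (real_markov theta (fun h => 1 * v h + 0) z).
      by congr (real_markov _ _ z); apply/funext => h; rewrite mul1r addr0.
    by rewrite aff// mul1r addr0.
  have E2 : complex.Im (Defs.markov theta f z) = 0.
    rewrite Im_markov; transitivity (real_markov theta (fun h => 0 * v h + 0) z).
      by congr (real_markov _ _ z); apply/funext => h; rewrite mul0r addr0.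
    by rewrite aff// mul0r addr0.
  by rewrite /f; case: (Defs.markov theta f z) E1 E2 => a b /= -> ->.
have fibre_ae : {ae lam x, forall z, tgt Gd z = x}.
  exists (~` fibre Gd x); split => //; last exact: system_fibre.
  by apply: measurableC; exact: (measurable_fibre bG).
exists y1; apply: filterS2 hy fibre_ae => z hz zx.
by have := hz zx; case.
Qed.

(** The set of arrows over a [mu]-null set is null, each [lam x] being carried by
    the fibre over [x]. *)
Lemma ae_star (P : G -> Prop) :
  {ae mu, forall x, forall g, tgt Gd g = x -> P g} -> {ae star mu lam, forall g, P g}.
Proof.
move=> [N [mN N0 sN]].
have mtN : measurable (tgt Gd @^-1` N).
  by rewrite -[X in measurable X]setTI; exact: (measurable_tgt bG).
exists (tgt Gd @^-1` N); split => //.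
- rewrite /= /star; apply/eqP; rewrite eq_le integral_ge0 ?andbT//.
  rewrite -(_ : (\int[mu]_(x in N) lam x (tgt Gd @^-1` N))%E = 0%E).
    rewrite [leRHS]integral_mkcond; apply: ge0_le_integral => //.
    + exact: system_measurable.
    + apply/measurable_restrict => //.
      by apply: measurable_funTS; exact: system_measurable.
    move=> x _; rewrite patchE; case: ifPn => // xN.
    rewrite -[leRHS]/(0%E : \bar R) -(system_fibre lam x); apply: measure_mono => //.
      by apply: measurableC; exact: (measurable_fibre bG).
    by move=> g /= gN gx; move: xN; rewrite -gx mem_set.
  by apply: null_set_integral => //; apply: measurable_funTS; exact: system_measurable.
- by move=> g /= nP; apply: sN => /= h; apply: nP; exact: h.
Qed.

Lemma liouville_reiter : liouville lam mu -> reiter lam mu.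
Proof.
move=> [pi api hL].
have [pi1 _ _] := api.
have [t tt rep] := adapted_transition bG api.
have [F [F0 mF Foo]] := exists_positive_integrable (star_sigma_finite bG lam_proper mu_sf).
have aeF := ae_fibre_integral_lty (fun h => ltW (F0 h)) mF Foo.
have tA n := transition_abel_mean bG lam_proper tt n.
have [theta thetaP] := choice (fun n =>
  let: ex_intro2 th h1 h2 := transition_adapted bG lam_proper (tA n) in
  ex_intro (fun th => adapted_probability lam th /\ represents lam th (abel_mean lam t n))
    th (conj h1 h2)).
exists theta; split; first by move=> n; have [] := thetaP n.
pose D n g : R := fine (invariance_defect lam (abel_mean lam t n) g).
have defE n g : fine (reiter_defect (theta n) g) = D n g.
  by have [_ rn] := thetaP n; rewrite (reiter_defectE bG (tA n) rn).
have D2 n g : `|D n g| <= 2.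
  have h2 := invariance_defect_le2 g (tA n).
  have h0 := invariance_defect_ge0 lam (abel_mean lam t n) g.
  rewrite ger0_norm ?fine_ge0// -lee_fin fineK// ge0_fin_numE//.
  by rewrite (le_lt_trans h2)// ltry.
have mD n : measurable_fun [set: G] (D n).
  apply: measurableT_comp => //; apply: measurable_invariance_defect => //.
  by case: (tA n).
have D0 : {ae star mu lam, forall g, D n g @[n --> \oo] --> (0 : R)}.
  apply: ae_star; apply: filterS2 hL aeF => x hx Fx.
  apply: (abel_mean_defect_cvg bG lam_proper tt F0 mF Fx).
  exact: liouville_real_harmonic tt rep pi1 hx.
move=> f [[mRe mIm] fi].
have comp_int (phi : G -> R) : measurable_fun [set: G] phi ->
    (forall g, `|phi g| <= ComplexField.Normc.normc (f g)) ->
    (\int[star mu lam]_g (`|phi g|)%:E < +oo)%E.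
  move=> mphi hphi; apply: le_lt_trans fi; apply: ge0_le_integral => //.
  - by apply/measurable_EFinP; exact: measurableT_comp.
  - apply/measurable_EFinP; rewrite (_ : (fun g => _) = Num.sqrt \o
        (fun g => complex.Re (f g) ^+ 2 + complex.Im (f g) ^+ 2)).
      apply: measurableT_comp.
        by apply: continuous_measurable_fun; exact: sqrt_continuous.
      by apply: measurable_funD; exact: measurable_funX.
    by apply/funext => g /=; case: (f g).
  - by move=> g _; rewrite lee_fin.
have cR : (fun n => Rintegral (star mu lam) [set: G]
    (fun g => D n g * complex.Re (f g))) @ \oo --> (0 : R).
  apply: (bounded_cvg_Rintegral (M := 2)) => //; apply: comp_int => // g.
  have := normc_ge_Re (f g); rewrite lecE/= => /andP[_].
  by case: (f g).
have cI : (fun n => Rintegral (star mu lam) [set: G]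
    (fun g => D n g * complex.Im (f g))) @ \oo --> (0 : R).
  apply: (bounded_cvg_Rintegral (M := 2)) => //; apply: comp_int => // g.
  by case: (f g) => a b /=; rewrite -sqrtr_sqr ler_wsqrtr// lerDr sqr_ge0.
have := cvg_complex0 cR cI.
set u := (X in X @ _ --> _ -> _); set w := (X in _ -> X @ _ --> _).
suff -> : w = u by [].
apply/funext => n; rewrite /u /w /cintegral; congr (complex.Complex _ _).
  by apply: eq_Rintegral => g _; rewrite defE; case: (f g) => a b /=; rewrite mul0r subr0.
by apply: eq_Rintegral => g _; rewrite defE; case: (f g) => a b /=; rewrite mul0r addr0.
Qed.

Lemma reiter_liouville : reiter lam mu -> liouville lam mu.
Proof.
move=> [theta [atheta hR]].
have [t tP] := choice (fun n =>
  let: ex_intro2 s h1 h2 := adapted_transition bG (atheta n) in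
  ex_intro (fun s => transition lam s /\ represents lam (theta n) s) s (conj h1 h2)).
have tt n : transition lam (t n) by have [] := tP n.
pose d n := invariance_defect lam (t n).
have d0 n g : (0 <= d n g)%E by exact: invariance_defect_ge0.
have md n : measurable_fun [set: G] (d n).
  by apply: measurable_invariance_defect => //; case: (tt n).
have d2 n g : (d n g <= 2%:E)%E by exact: invariance_defect_le2.
have dfin n g : d n g \is a fin_num by rewrite ge0_fin_numE// (le_lt_trans (d2 n g))// ltry.
have [F [F0 mF Foo]] := exists_positive_integrable (star_sigma_finite bG lam_proper mu_sf).
have Fok : [/\ forall h, (0 <= F h)%E, measurable_fun [set: G] F &
  (\int[star mu lam]_h F h < +oo)%E] by split => // h; exact: ltW.
(* The Reiter condition for the function [H]. *)
have vanishing (H : G -> \bar R) : [/\ forall h, (0 <= H h)%E,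
    measurable_fun [set: G] H & (\int[star mu lam]_h H h < +oo)%E] ->
    forall e : R, 0 < e -> exists n, (\int[star mu lam]_h (H h * d n h) <= e%:E)%E.
  move=> [H0 mH Hoo] e e0.
  pose f g : R[i] := complex.Complex (fine (H g)) 0.
  have mfH : measurable_fun [set: G] (fun g => fine (H g)) by exact: measurableT_comp.
  have fi : cintegrable (star mu lam) f.
    split; first by split => //; exact: measurable_cst.
    rewrite (_ : (fun g => _) = (fun g => (fine (H g))%:E)).
      by rewrite integral_fine_density.
    apply/funext => g /=.
    by rewrite expr0n/= addr0 sqrtr_sqr ger0_norm// fine_ge0.
  have /cvg_Re0/cvgr0Pnorm_le/(_ _ e0)[n _ /(_ n (leqnn n))] := hR f fi.
  rewrite /cintegral/= => hn; exists n.
  have -> : (\int[star mu lam]_h (H h * d n h) =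
      \int[star mu lam]_h (fine (d n h) * fine (H h))%:E)%E.
    apply: ge0_ae_eq_integral => //.
    - exact: emeasurable_funM.
    - by apply/measurable_EFinP; apply: measurable_funM => //; exact: measurableT_comp.
    - by move=> h _; rewrite mule_ge0.
    - by move=> h _; rewrite lee_fin mulr_ge0// fine_ge0.
    apply: filterS (ae_lty_integral H0 mH Hoo) => h Hh _.
    have HK : (fine (H h))%:E = H h by rewrite fineK// ge0_fin_numE.
    by rewrite EFinM HK fineK// muleC.
  have ifin : (\int[star mu lam]_h (fine (d n h) * fine (H h))%:E)%E \is a fin_num.
    rewrite ge0_fin_numE; last first.
      by apply: integral_ge0 => h _; rewrite lee_fin mulr_ge0// fine_ge0.
    apply: (@le_lt_trans _ _ (\int[star mu lam]_h (2%:E * H h))%E); last first.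
      rewrite ge0_integralZl//.
      by rewrite -[X in (_ * X)%E]fineK ?ge0_fin_numE ?integral_ge0// -EFinM ltry.
    apply: ge0_le_integral => //.
    - by move=> h _; rewrite lee_fin mulr_ge0// fine_ge0.
    - by apply/measurable_EFinP; apply: measurable_funM => //; exact: measurableT_comp.
    - exact: measurable_funeM.
    move=> h _; rewrite EFinM fineK//; apply: lee_pmul => //.
      by rewrite lee_fin fine_ge0.
    by case: (H h) (H0 h).
  rewrite -(fineK ifin) lee_fin; apply: le_trans hn; apply: le_trans (ler_norm _).
  rewrite /Rintegral le_eqVlt; apply/orP; left; apply/eqP; congr fine.
  apply: eq_integral => g _; have [_ rn] := tP n.
  by rewrite (reiter_defectE bG (tt n) rn) mul0r subr0.
have [l hl] := exists_mean_with_constant_harmonics bG lam_proper tt vanishing F0 Fok.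
have s01 : 0 <= (1 / 2 : R) < 1 by lra.
have ttau := transition_geometric_mean bG s01 (fun j => tt (l j)).
have [pi api rep] := transition_adapted bG lam_proper ttau.
exists pi => //; apply: filterS hl => x hx f Lf.
have [pi1 _ _] := api.
exact: (harmonicP bG ttau rep pi1 hx Lf).
Qed.

End equivalence.

Theorem theorem6p1 (R : realType) (dX dG : measure_display)
    (X : measurableType dX) (G : measurableType dG) (Gd : groupoid X G)
    (lam : borel_system R Gd) (mu : {measure set X -> \bar R}) :
  measured_groupoid lam mu -> sigma_finite [set: X] mu ->
  (liouville lam mu <-> reiter lam mu).
Proof.
move=> [bG _ lam_proper] mu_sf.
by split; [exact: liouville_reiter|exact: reiter_liouville].
Qed.
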